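(* Let $D$ be a non-commutative division ring with center $F$, let $M$ be a non-abelian locally solvable maximal subgroup of $D^*$, and let $A$ be a maximal abelian normal subgroup of $M$. Put $L=F(A)$, $K=C_D(L)$ and $V=C_M(A)$. Then: (i) $A=L^*$; (ii) either $A=F^*$, or $V=L^*=K^*$ and $K$ is a maximal subfield of $D$.
   Context: $D^*$ is the multiplicative group of $D$; a maximal subgroup is a proper subgroup maximal among proper subgroups. Locally solvable: every finitely generated subgroup is solvable. A maximal abelian normal subgroup of $M$ is an abelian normal subgroup of $M$ not properly contained in another abelian normal subgroup of $M$. For a subset $S$, $F(S)$ is the division subring of $D$ generated by $F\cup S$; $C_D(S)=\{x\in D: xs=sx \ \forall s\in S\}$ and $C_M(S)=C_D(S)\cap M$. For a division subring $L$, $L^*=L\setminus\{0\}$. *)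

(* Defs.v *)
From mathcomp Require Import all_boot all_algebra.
Set Implicit Arguments. Unset Strict Implicit. Unset Printing Implicit Defensive.
Import GRing.Theory.
Local Open Scope ring_scope.

Section Defs.
Variable D : unitRingType.

Definition is_division_ring : Prop := forall x : D, x != 0 -> x \is a GRing.unit.

Definition noncommutative_ring : Prop := exists x y : D, x * y != y * x.

Definition subs (S T : D -> Prop) : Prop := forall x, S x -> T x.
Definition seteq (S T : D -> Prop) : Prop := forall x, S x <-> T x.

Definition units_set : D -> Prop := fun x => x != 0.
Definition star (L : D -> Prop) : D -> Prop := fun x => L x /\ x != 0.

Definition mgroup (G : D -> Prop) : Prop :=
  [/\ subs G units_set, G 1,
      (forall x y, G x -> G y -> G (x * y)) & (forall x, G x -> G x^-1)].

Definition maximal_subgroup (M : D -> Prop) : Prop :=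
  [/\ mgroup M, ~ seteq M units_set &
      forall H, mgroup H -> subs M H -> seteq H M \/ seteq H units_set].

Definition gen (X : D -> Prop) : D -> Prop :=
  fun x => forall H, mgroup H -> subs X H -> H x.

Definition commutators (H : D -> Prop) : D -> Prop :=
  fun z => exists x y, [/\ H x, H y & z = x^-1 * y^-1 * x * y].

Definition derived (H : D -> Prop) : D -> Prop := gen (commutators H).

Definition solvable_grp (H : D -> Prop) : Prop :=
  exists n, subs (iter n derived H) (fun x => x = 1).

Definition locally_solvable (M : D -> Prop) : Prop :=
  forall s : seq D, (forall x, x \in s -> M x) ->
    solvable_grp (gen (fun x => x \in s)).

Definition abelian_set (H : D -> Prop) : Prop :=
  forall x y, H x -> H y -> x * y = y * x.

Definition normal_sub (A M : D -> Prop) : Prop :=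
  [/\ mgroup A, subs A M & forall m a, M m -> A a -> A (m^-1 * a * m)].

Definition max_abelian_normal (A M : D -> Prop) : Prop :=
  [/\ normal_sub A M, abelian_set A &
      forall B, normal_sub B M -> abelian_set B -> subs A B -> seteq B A].

Definition center : D -> Prop := fun x => forall y, x * y = y * x.

Definition centralizer (S : D -> Prop) : D -> Prop :=
  fun x => forall s, S s -> x * s = s * x.

Definition centralizer_in (M S : D -> Prop) : D -> Prop :=
  fun x => M x /\ centralizer S x.

Definition division_subring (L : D -> Prop) : Prop :=
  [/\ L 0, L 1, (forall x y, L x -> L y -> L (x - y)),
      (forall x y, L x -> L y -> L (x * y)) &
      (forall x, L x -> x != 0 -> L x^-1)].

Definition adjoin (S : D -> Prop) : D -> Prop :=
  fun x => forall L, division_subring L -> subs center L -> subs S L -> L x.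

Definition subfield (K : D -> Prop) : Prop :=
  division_subring K /\ abelian_set K.

Definition maximal_subfield (K : D -> Prop) : Prop :=
  subfield K /\ forall K', subfield K' -> subs K K' -> seteq K' K.

End Defs.

(* Main.v *)
(* By maximality and the Cartan-Brauer-Hua theorem, [M] contains [P^*] for every
   proper division subring [P] normalized by [M] (here [L] and [K]), so all
   reduces to: a division subring [K] with [K^*] locally solvable is commutative.

   If [x] and [y] do not commute, the group [H] generated by [x], [1 + x], [y],
   [1 + y] is solvable; let [B] be the last term of its derived series that does
   not centralize [x] and [y].  It has class at most 2 and is normalized by [h]
   and [1 + h], where [h] is [x] or [y] and [h b <> b h] for some [b] in [B].
   As in Hua's identity, [h] is a rational expression in the commutators
   [be = [h, b]] and [ga = [1 + h, b]], which lie in [B].  Conjugating by [b]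
   yields a relation between six monomials in [be] and [ga], and independence of
   the characters of [B] forces [B] to contain anticommuting [i], [u] with
   [i^2 = -1] and [h] to be a root of one of four explicit quadratic polynomials.
   But [i] and [u] span a quaternion-like algebra in which one finds a
   noncommuting pair avoiding these roots. *)
From Stdlib Require Import Classical Ncring Ncring_tac.
Require Import Defs.
From mathcomp Require Import all_boot all_algebra.
Set Implicit Arguments. Unset Strict Implicit. Unset Printing Implicit Defensive.
Import GRing.Theory.
Local Open Scope ring_scope.

(** These two instances make the tactic [non_commutative_ring] applicable over a [unitRingType]. *)
#[local] Instance unitRing_ops (D : unitRingType) :
  @Ring_ops D 0 1 +%R *%R (fun x y => x - y) (@GRing.opp D) eq := {}.
#[local] Instance unitRing_Ring (D : unitRingType) :
  @Ring D 0 1 +%R *%R (fun x y => x - y) (@GRing.opp D) eq (unitRing_ops D).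
Proof.
split; try exact: eq_equivalence;
  rewrite /equality /addition /multiplication /subtraction /opposite
    /zero /one /=; try by move=> ? ? -> ? ? ->.
- by move=> ? ? ->.
- exact: add0r.
- exact: addrC.
- exact: addrA.
- exact: mul1r.
- exact: mulr1.
- exact: mulrA.
- exact: mulrDl.
- by move=> x y z; exact: mulrDr.
- by [].
- exact: subrr.
Qed.

(** * Division rings, generated subgroups and derived series *)

Section DivisionRing.
Variables (D : unitRingType) (divD : is_division_ring D).
Implicit Types (x y z g h : D) (S G H K M : D -> Prop).

Lemma div_mul_eq0 x y : x * y = 0 -> x = 0 \/ y = 0.
Proof.
have [-> _|x0 xy0] := eqVneq x 0; [by left | right].
by apply: (mulrI (divD x0)); rewrite mulr0.
Qed.

Lemma div_mul_neq0 x y : x != 0 -> y != 0 -> x * y != 0.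
Proof.
move=> x0 y0; apply/negP=> /eqP /div_mul_eq0.
by case=> /eqP; apply/negP.
Qed.

Lemma div_inv_neq0 x : x != 0 -> x^-1 != 0.
Proof.
move=> x0; apply/negP=> /eqP xV; have := mulVr (divD x0).
by rewrite xV mul0r => /esym /eqP; rewrite oner_eq0.
Qed.

Lemma centralizer_division_subring S : division_subring (centralizer S).
Proof.
split=> [s _|s _|x y Cx Cy s Ss|x y Cx Cy s Ss|x Cx _ s Ss].
- by rewrite mul0r mulr0.
- by rewrite mul1r mulr1.
- by rewrite mulrBl mulrBr Cx ?Cy.
- by rewrite -mulrA Cy // mulrA Cx // mulrA.
- by apply/esym/commrV/esym/Cx.
Qed.

Lemma division_subring_add K x y : division_subring K -> K x -> K y -> K (x + y).
Proof. by case=> K0 _ KB _ _ Kx Ky; rewrite -[y]opprK -[- y]sub0r; do 2?apply: (KB). Qed.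

Lemma star_mgroup K : division_subring K -> mgroup (star K).
Proof.
case=> K0 K1 _ KM KV; split=> [x []//|||x [Kx x0]].
- by split=> //; exact: oner_neq0.
- by move=> x y [Kx x0] [Ky y0]; split; [exact: KM | exact: div_mul_neq0].
- by split; [exact: KV | exact: div_inv_neq0].
Qed.

Lemma units_mgroup : mgroup (@units_set D).
Proof.
split=> //; [exact: oner_neq0 | exact: div_mul_neq0 | exact: div_inv_neq0].
Qed.

Lemma gen_sub S : subs S (gen S).
Proof. by move=> x Sx G _; apply. Qed.

Lemma gen_min S G : mgroup G -> subs S G -> subs (gen S) G.
Proof. by move=> grG SG x; apply. Qed.

Lemma gen_mgroup S : subs S (@units_set D) -> mgroup (gen S).
Proof.
move=> SU; split=> [|G [] //|x y gx gy G grG SG|x gx G grG SG].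
- exact: gen_min units_mgroup SU.
- by case: (grG) => _ _ GM _; apply: GM; [exact: gx | exact: gy].
- by case: (grG) => _ _ _ GV; apply: GV; exact: gx.
Qed.

Lemma commutators_sub G : mgroup G -> subs (commutators G) G.
Proof.
move=> [_ _ GM GV] _ [x [y [Gx Gy ->]]].
by apply: (GM) => //; apply: (GM) => //; apply: GM; exact: GV.
Qed.

Lemma derived_mgroup G : mgroup G -> mgroup (derived G).
Proof.
move=> grG; apply: gen_mgroup => x /(commutators_sub grG).
by case: grG => GU _ _ _ /GU.
Qed.

Lemma derived_sub G : mgroup G -> subs (derived G) G.
Proof. by move=> grG; apply: gen_min (commutators_sub grG). Qed.

Lemma derivedn_mgroup G n : mgroup G -> mgroup (iter n (@derived D) G).
Proof. by move=> grG; elim: n => //= n; exact: derived_mgroup. Qed.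

Lemma derivedn_sub G n : mgroup G -> subs (iter n (@derived D) G) G.
Proof.
move=> grG; elim: n => //= n IHn x /derived_sub.
by move=> /(_ (derivedn_mgroup n grG)); exact: IHn.
Qed.

(** * Stability under conjugation *)

Definition conj_stable g G := forall a, G a -> G (g^-1 * a * g).

Lemma conj_mgroup g G : g != 0 -> mgroup G ->
  mgroup (fun x => x != 0 /\ G (g^-1 * x * g)).
Proof.
move=> g0 [GU G1 GM GV]; have gU := divD g0.
split=> [x []//||x y [x0 Gx] [y0 Gy]|x [x0 Gx]]; split.
- exact: oner_neq0.
- by rewrite mulr1 mulVr.
- exact: div_mul_neq0.
- by have := GM _ _ Gx Gy; rewrite !mulrA mulrK.
- exact: div_inv_neq0.
- have xU := divD x0; have := GV _ Gx.
  by rewrite !invrM ?unitrMr ?unitrV // invrK mulrA.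
Qed.

(** Commutators are mapped to commutators, and by [conj_mgroup] the elements whose conjugate lies in
    the derived group form a group. *)
Lemma conj_stable_derived g G : g != 0 -> mgroup G ->
  conj_stable g G -> conj_stable g (derived G).
Proof.
move=> g0 grG gG a; have gU := divD g0; have [GU _ _ GV] := grG.
have grH := conj_mgroup g0 (derived_mgroup grG).
suff sub : subs (derived G) (fun x => x != 0 /\ derived G (g^-1 * x * g)).
  by move=> /sub [].
apply: gen_min grH _ => _ [x [y [Gx Gy ->]]].
have [x0 y0] := (GU _ Gx, GU _ Gy); have [xU yU] := (divD x0, divD y0).
split.
  by have [DU _ _ _] := derived_mgroup grG; apply: DU; apply: gen_sub; exists x, y.
apply: gen_sub; exists (g^-1 * x * g), (g^-1 * y * g).
split; [exact: gG | exact: gG |].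
rewrite !invrM ?unitrMr ?unitrV // invrK.
by rewrite !mulrA !mulrK.
Qed.

Lemma conj_stable_derivedn g G n : g != 0 -> mgroup G ->
  conj_stable g G -> conj_stable g (iter n (@derived D) G).
Proof.
move=> g0 grG gG; elim: n => //= n; apply: conj_stable_derived => //.
exact: derivedn_mgroup.
Qed.

Lemma mem_conj_stable g G : mgroup G -> G g -> conj_stable g G.
Proof.
by move=> [_ _ GM GV] Gg a Ga; apply: (GM) => //; apply: GM => //; exact: GV.
Qed.

Lemma derived_mono G H : subs G H -> subs (derived G) (derived H).
Proof.
move=> GH x dGx K grK HK; apply: dGx => // _ [y [z [Gy Gz ->]]].
by apply: HK; exists y, z; split; [exact: GH | exact: GH |].
Qed.

(** * Reduction to a normalized group of class at most 2 *)

(** For an infinite [G], stability under [g] does not imply stability under [g^-1], so both are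
    required. *)
Definition normalizes g G := conj_stable g G /\ conj_stable g^-1 G.

(* [locked] so that [mulrA] does not unfold it. *)
Definition conj_ratio a b : D := locked (b * a * b^-1 * a^-1).

Lemma conj_ratioE a b : conj_ratio a b = b * a * b^-1 * a^-1.
Proof. by rewrite /conj_ratio -lock. Qed.

Definition class2 G :=
  forall a b c, G a -> G b -> G c -> c * conj_ratio a b = conj_ratio a b * c.

(** The trivial term centralizes [x] and [y], while [G] itself does not, as it contains [x]; the
    induction descends from [n] to the passage between the two. *)
Lemma last_noncentral_derived G x y n : G x -> x * y <> y * x ->
  subs (iter n (@derived D) G) (fun z => z = 1) ->
  exists k, subs (iter k.+1 (@derived D) G) (fun z => z * x = x * z /\ z * y = y * z)
    /\ ~ subs (iter k (@derived D) G) (fun z => z * x = x * z /\ z * y = y * z).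
Proof.
move=> Gx xy Gn1.
have : subs (iter n (@derived D) G) (fun z => z * x = x * z /\ z * y = y * z).
  by move=> z /Gn1 ->; rewrite !mul1r !mulr1.
elim: n {Gn1} => [/(_ x Gx) [_ /xy] //|n IHn cGn1].
by have [/IHn //|ncG] := classic (subs (iter n (@derived D) G)
  (fun z => z * x = x * z /\ z * y = y * z)); exists n.
Qed.

Lemma solvable_class2_normalized K x y :
  division_subring K -> locally_solvable (star K) ->
  K x -> K y -> x * y <> y * x ->
  exists B h b, [/\ mgroup B /\ subs B K, class2 B, h = x \/ h = y,
    normalizes h B /\ normalizes (1 + h) B & B b /\ h * b <> b * h].
Proof.
move=> dK lsK Kx Ky xy; have [K0 K1 KB KM KV] := dK.
have KD z t : K z -> K t -> K (z + t) by exact: division_subring_add.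
have nz1 z t : z * t <> t * z -> z != 0 /\ 1 + z != 0.
  move=> zt; split; apply/eqP=> z0; apply: zt; first by rewrite z0 mul0r mulr0.
  by move/eqP: z0; rewrite addrC addr_eq0 => /eqP ->; rewrite mulN1r mulrN1.
have [x0 x10] := nz1 _ _ xy; have [y0 y10] := nz1 _ _ (nesym xy).
(* With [1 + x] and [1 + y] among the generators, [1 + h] will normalize [B] as well as [h]. *)
pose s := [:: x; 1 + x; y; 1 + y].
have sK z : z \in s -> star K z.
  rewrite !inE => /or4P [] /eqP ->; split=> //; exact: KD.
pose H := gen (fun z => z \in s).
have grH : mgroup H by apply: gen_mgroup => z /sK [].
have Hs z : z \in s -> H z by exact: gen_sub.
have HK : subs H (star K) by apply: gen_min; [exact: star_mgroup | exact: sK].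
have [n Hn] := lsK s sK.
have Hx : H x by apply: Hs; rewrite inE eqxx.
have [k [cHk ncHk]] := last_noncentral_derived Hx xy Hn.
pose B := iter k (@derived D) H.
have grB : mgroup B := derivedn_mgroup k grH.
have BH : subs B H := derivedn_sub (n := k) grH.
have nB g : H g -> normalizes g B.
  move=> Hg; have [HU _ _ HV] := grH.
  by split; apply: conj_stable_derivedn; rewrite ?div_inv_neq0 //;
    first [exact: HU | apply: mem_conj_stable => //; exact: HV].
(* [derived B] centralizes [x] and [y], hence all four generators; so [H], and with it [B],
   centralizes [derived B]. *)
have cB : subs H (star (centralizer (derived B))).
  apply: gen_min; first exact: star_mgroup (centralizer_division_subring _).
  move=> z; rewrite !inE => /or4P [] /eqP -> ; split=> // t Bt;
    have [tx ty] := cHk t Bt; by rewrite ?mulrDl ?mulrDr ?mul1r ?mulr1 ?tx ?ty.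
have [b [Bb hb]] : exists b, B b /\ ~ (b * x = x * b /\ b * y = y * b).
  apply: NNPP => nex; apply: ncHk => z Bz; apply: NNPP => nz.
  by apply: nex; exists z.
have [h [hxy hb']] : exists h, (h = x \/ h = y) /\ h * b <> b * h.
  have [bx|bx] := classic (b * x = x * b).
    by exists y; split; [right | move=> by_; apply: hb].
  by exists x; split; [left | move=> /esym].
exists B, h, b; split=> //.
- by split=> // z /BH /HK [].
- have [_ _ _ BV] := grB; move=> a d c Ba Bd Bc; have [+ _] := cB _ (BH _ Bc).
  rewrite conj_ratioE; apply; apply: gen_sub; exists d^-1, a^-1.
  by split; [exact: BV | exact: BV | rewrite !invrK].
- by case: hxy => ->; split; apply: nB; apply: Hs; rewrite !inE eqxx ?orbT.
Qed.

(** * Weights and independence of characters *)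

(** For units [b] this says [b * r * b^-1 = lam b * r]: a common eigenvector of the conjugations by
    [G]. *)
Definition weight G (lam : D -> D) r := forall b, G b -> b * r = lam b * r * b.

Definition central_in G z := G z /\ forall c, G c -> c * z = z * c.

Definition central_char G (lam : D -> D) := forall b, G b -> central_in G (lam b).

Lemma weightD G lam r s : weight G lam r -> weight G lam s -> weight G lam (r + s).
Proof. by move=> wr ws b Gb; rewrite !mulrDr mulrDl (wr b Gb) (ws b Gb). Qed.

Lemma weight_eq G lam mu r : weight G lam r ->
  (forall b, G b -> lam b = mu b) -> weight G mu r.
Proof. by move=> wr eq b Gb; rewrite (wr b Gb) (eq b Gb). Qed.

Lemma weightMl G lam z r : centralizer G z -> central_char G lam ->
  weight G lam r -> weight G lam (z * r).
Proof.
move=> cz clam wr b Gb; have [Gl _] := clam b Gb.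
by rewrite mulrA -(cz b Gb) -mulrA (wr b Gb) !mulrA (cz _ Gl).
Qed.

(* Dedekind's independence of characters: conjugating the relation by a [b]
   that separates [lam] from the first weight of [Q] and subtracting cancels
   that term. *)
Lemma weight_indep G lam r (Q : seq ((D -> D) * D)) : mgroup G ->
  central_char G lam -> weight G lam r ->
  List.Forall (fun q => [/\ central_char G q.1, weight G q.1 q.2 &
    exists2 b, G b & lam b <> q.1 b]) Q ->
  r + \sum_(q <- Q) q.2 = 0 -> r = 0.
Proof.
move=> grG clam; have [m] := ubnP (size Q); elim: m => // m IHm in r Q *.
case: Q => [|[mu s] Q] /=; first by rewrite big_nil addr0.
move=> szQ wr /List.Forall_cons_iff [/= [cmu ws [b Gb lmu]] FQ].
rewrite big_cons /= => sum0; have [GU _ _ _] := grG; have bU := divD (GU _ Gb).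
have cdiff nu : central_char G nu -> centralizer G (nu b - mu b).
  move=> cnu c Gc; have [[_ cl] [_ cm]] := (cnu b Gb, cmu b Gb).
  by rewrite mulrBr mulrBl (cl c Gc) (cm c Gc).
have sum1 : lam b * r + (mu b * s + \sum_(q <- Q) q.1 b * q.2) = 0.
  apply: (mulIr bU); rewrite mul0r -[RHS](mulr0 b) -[X in b * X]sum0.
  rewrite !mulrDr !mulrDl.
  rewrite (wr b Gb) (ws b Gb) mulr_suml mulr_sumr; congr (_ + (_ + _)).
  elim: Q FQ {szQ sum0} => [|q Q IHQ]; first by rewrite !big_nil.
  move=> /List.Forall_cons_iff [[_ wq _] /IHQ eqQ].
  by rewrite !big_cons eqQ (wq b Gb).
have : (lam b - mu b) * r = 0.
  pose Q' := [seq (q.1, (q.1 b - mu b) * q.2) | q <- Q].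
  apply: (IHm _ Q').
  - by rewrite size_map.
  - by apply: weightMl => //; exact: cdiff.
  - rewrite {}/Q' {sum0 sum1 szQ}.
    elim: Q FQ => //= q Q IHQ /List.Forall_cons_iff [[cq wq [c Gc ne]] /IHQ FQ].
    apply: List.Forall_cons => //=; split=> //; last by exists c.
    by apply: weightMl => //; exact: cdiff.
  - rewrite big_map /=; under eq_bigr => q _ do rewrite mulrBl.
    rewrite sumrB -mulr_sumr mulrBl.
    have -> : \sum_(q <- Q) q.2 = - (r + s).
      by apply/eqP; rewrite -addr_eq0 addrC -addrA sum0.
    move: sum1; set T := \sum_(q <- Q) _ => sum1; transitivity (lam b * r + (mu b * s + T)) => //.
    non_commutative_ring.
by case/div_mul_eq0 => // /eqP; rewrite subr_eq0 => /eqP.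
Qed.

(** Independence is applied to [r1], then to [r2]; this serves to split a relation grouped by three
    distinct characters. *)
Lemma weight_indep3 G lam1 lam2 lam3 r1 r2 r3 : mgroup G ->
  central_char G lam1 -> central_char G lam2 -> central_char G lam3 ->
  weight G lam1 r1 -> weight G lam2 r2 -> weight G lam3 r3 ->
  (exists2 b, G b & lam1 b <> lam2 b) ->
  (exists2 b, G b & lam1 b <> lam3 b) ->
  (exists2 b, G b & lam2 b <> lam3 b) ->
  r1 + r2 + r3 = 0 -> [/\ r1 = 0, r2 = 0 & r3 = 0].
Proof.
move=> grG c1 c2 c3 w1 w2 w3 [b Gb n12] [c Gc n13] [d Gd n23] sum0.
have r10 : r1 = 0.
  apply: (weight_indep (Q := [:: (lam2, r2); (lam3, r3)]) grG c1 w1).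
    by do !apply: List.Forall_cons => //; split=> //; [exists b | exists c].
  by rewrite !big_cons big_nil addr0 addrA.
have r20 : r2 = 0.
  apply: (weight_indep (Q := [:: (lam3, r3)]) grG c2 w2).
    by do !apply: List.Forall_cons => //; split=> //; exists d.
  by move: sum0; rewrite big_seq1 r10 add0r.
by split=> //; move: sum0; rewrite r10 r20 !add0r.
Qed.

(** * Commutators of [b] with [h] and [1 + h] *)

Section Twist.
Variables (B : D -> Prop) (grB : mgroup B) (clB : class2 B).
Implicit Types (a b c be ga : D).

Let BU a : B a -> a != 0. Proof. by case: grB => BU _ _ _; exact: BU. Qed.
Let B1 : B 1. Proof. by case: grB. Qed.
Let BM a b : B a -> B b -> B (a * b). Proof. by case: grB => _ _ BM _; exact: BM. Qed.
Let BV a : B a -> B a^-1. Proof. by case: grB => _ _ _; exact. Qed.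

Lemma conj_ratio_central a : B a -> central_char B (conj_ratio a).
Proof.
move=> Ba b Bb; split; last by move=> c Bc; exact: clB.
rewrite conj_ratioE.
by apply: (BM); [apply: (BM); [exact: BM | exact: BV] | exact: BV].
Qed.

Lemma conj_ratio_weight a : B a -> weight B (conj_ratio a) a.
Proof.
move=> Ba b Bb; have [aU bU] := (divD (BU Ba), divD (BU Bb)).
by rewrite conj_ratioE mulrVK // mulrVK.
Qed.

(* [be] and [ga] are the commutators of [b] with [h] and with [1 + h], so that
   [h] can be recovered from [be] and [ga], see [twisted_conj]. *)
Definition twisted h b be ga :=
  [/\ [/\ B b, B be & B ga], h * b = be * b * h, (1 + h) * b = ga * b * (1 + h)
    & h * b <> b * h].

(** The hypotheses read [be * k = h] and [ga * (1 + k) = 1 + h], and subtracting isolates [k].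
    Conjugating by [b] once more replaces [be], [ga], [k] by [x * be], [y * ga], [k2]. *)
Lemma twisted_conj h b be ga : twisted h b be ga ->
  let k := b * h * b^-1 in let k2 := b * k * b^-1 in
  let x := conj_ratio be b in let y := conj_ratio ga b in
  [/\ be * k = h, (be - ga) * k = ga - 1, x * be * k2 = k,
      (x * be - y * ga) * k2 = y * ga - 1 & k <> h].
Proof.
case=> [[Bb Bbe Bga] Eh E1h hb] k k2 x y.
have bU := divD (BU Bb).
have bek : be * k = h by rewrite /k !mulrA -Eh mulrK.
have gak : ga * (1 + k) = 1 + h.
  rewrite -[RHS](mulrK bU) E1h -!mulrA; congr (ga * _).
  by rewrite mulrDl mulrDr mul1r mulrV // /k mulrA.
have diff : (be - ga) * k = ga - 1.
  have -> : (be - ga) * k = be * k - ga * (1 + k) + ga by non_commutative_ring.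
  by rewrite bek gak; non_commutative_ring.
have xb : b * be = x * be * b := conj_ratio_weight Bbe Bb.
have yb : b * ga = y * ga * b := conj_ratio_weight Bga Bb.
have k2b : k2 * b = b * k by rewrite /k2 mulrVK.
split=> //.
- apply: (mulIr bU); rewrite -mulrA k2b mulrA -xb -mulrA bek.
  by rewrite /k mulrVK.
- apply: (mulIr bU); rewrite -mulrA k2b mulrA mulrBl -xb -yb -mulrBr -mulrA diff.
  by rewrite mulrBr mulrBl yb mulr1 mul1r.
- by move=> kh; apply: hb; rewrite -{1}kh /k mulrVK.
Qed.

(** Eliminates [k] and [k2] from [twisted_conj]: both [ga - 1] and [y * ga - 1] are left multiples
    of [k2], and they commute, so multiplying each by the other and cancelling [k2] leaves an
    identity in [be] and [ga]. *)
Lemma twisted_relation h b be ga : twisted h b be ga ->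
  let x := conj_ratio be b in let y := conj_ratio ga b in
  x * y * (ga * (be * be)) - x * y * (ga * ga * be) - x * (be * be) + x * be
    + y * (ga * ga) - y * ga = 0.
Proof.
move=> tw x y; have /= := twisted_conj tw; rewrite -/x -/y.
set k := b * h * b^-1; set k2 := b * k * b^-1 => -[bek diff xk2 dk2 _]; clearbody k2; clearbody k.
have [[Bb Bbe Bga] _ _ hb] := tw.
have [[Bx cx] [By cy]] := (conj_ratio_central Bbe Bb, conj_ratio_central Bga Bb).
rewrite -/x in Bx cx; rewrite -/y in By cy; clearbody x y.
have k20 : k2 != 0.
  apply/eqP=> k20; move: bek; rewrite -xk2 k20 !mulr0 => h0.
  by apply: hb; rewrite -h0 mul0r mulr0.
have X : x * ((be - ga) * be) * k2 = ga - 1.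
  have cxd : (be - ga) * x = x * (be - ga).
    by rewrite mulrBl mulrBr (cx _ Bbe) (cx _ Bga).
  by rewrite -diff -xk2 !mulrA cxd.
have : (x * ((y * ga - 1) * ((be - ga) * be))
    - (x * ((ga - 1) * be) - y * ((ga - 1) * ga))) * k2 = 0.
  have -> : x * ((ga - 1) * be) - y * ((ga - 1) * ga) = (ga - 1) * (x * be - y * ga).
    rewrite !(mulrBl, mulrBr) !mulrA !mul1r (cx _ Bga) (cy _ Bga).
    by non_commutative_ring.
  have -> : x * ((y * ga - 1) * ((be - ga) * be)) = (y * ga - 1) * (x * ((be - ga) * be)).
    by rewrite !mulrA; congr (_ * _ * _); rewrite mulrBl mulrBr mul1r mulr1 (cx _ (BM By Bga)).
  rewrite mulrBl -(mulrA (y * ga - 1)) -(mulrA (ga - 1)) X dk2.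
  rewrite !(mulrBl, mulrBr) !mulrA (cy _ Bga).
  by non_commutative_ring.
case/div_mul_eq0=> [<-|/eqP]; last by rewrite (negPf k20).
by non_commutative_ring.
Qed.

(** If both ratios are [1], then [k] and [k2] satisfy the same equations. For [be <> ga] this gives
    [k2 = k], for [be = ga] it gives [be = 1]; either way [k = h]. *)
Lemma twisted_nontrivial h b be ga : twisted h b be ga ->
  ~ (conj_ratio be b = 1 /\ conj_ratio ga b = 1).
Proof.
move=> tw [x1 y1]; have /= := twisted_conj tw; rewrite x1 y1 !mul1r.
set k := b * h * b^-1; set k2 := b * k * b^-1 => -[bek diff bek2 dk2 kh].
have [bega|bega] := eqVneq be ga.
  move: diff; rewrite bega subrr mul0r => /esym/eqP; rewrite subr_eq0 => /eqP ga1.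
  by apply: kh; rewrite -bek bega ga1 mul1r.
have bg0 : be - ga != 0 by rewrite subr_eq0.
have kk2 : k2 = k by apply: (mulrI (divD bg0)); rewrite diff dk2.
by apply: kh; rewrite -bek -{1}bek2 kk2.
Qed.

Lemma central_inM y z : central_in B y -> central_in B z -> central_in B (y * z).
Proof.
move=> [By cy] [Bz cz]; split; first exact: BM.
by move=> c Bc; rewrite mulrA (cy c Bc) -mulrA (cz c Bc) mulrA.
Qed.

Lemma central_in_char lam mu : central_char B lam -> central_char B mu ->
  central_char B (fun b => lam b * mu b).
Proof. by move=> cl cm b Bb; apply: central_inM; [exact: cl | exact: cm]. Qed.

Lemma central_char1 : central_char B (fun=> 1).
Proof. by move=> b _; split; [exact: B1 | move=> c _; rewrite mulr1 mul1r]. Qed.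

Lemma weightM lam mu r s : central_char B mu -> B r ->
  weight B lam r -> weight B mu s -> weight B (fun b => lam b * mu b) (r * s).
Proof.
move=> cm Br wr ws b Bb; have [_ cmb] := cm b Bb.
rewrite mulrA (wr b Bb) -(mulrA _ b) (ws b Bb) !mulrA -(mulrA (lam b) r).
by rewrite (cmb r Br) !mulrA.
Qed.

Lemma weight1 z : centralizer B z -> weight B (fun=> 1) z.
Proof. by move=> cz b Bb; rewrite mul1r cz. Qed.

Lemma conj_ratio_eq1 a : B a -> centralizer B a -> forall b, B b -> conj_ratio a b = 1.
Proof.
move=> Ba ca b Bb; rewrite !conj_ratioE -(ca b Bb) mulrK ?mulrV //; apply: divD; exact: BU.
Qed.

Lemma conj_ratioN a b : conj_ratio (- a) b = conj_ratio a b.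
Proof. by rewrite !conj_ratioE invrN mulrN mulrN !mulNr opprK. Qed.

Lemma div_sq_eq y z : y * z = z * y -> y * y = z * z -> y = z \/ y = - z.
Proof.
move=> yz sq; have : (y - z) * (y + z) = 0.
  have -> : (y - z) * (y + z) = y * y - z * z + (y * z - z * y).
    by non_commutative_ring.
  by rewrite sq yz !subrr addr0.
by case/div_mul_eq0 => /eqP; [rewrite subr_eq0 | rewrite addr_eq0] => /eqP; [left|right].
Qed.

Lemma div_sq_eq1 z : z * z = 1 -> z = 1 \/ z = - 1.
Proof. by move=> z1; apply: div_sq_eq; rewrite ?mulr1 ?mul1r. Qed.

Lemma centralizer1 S : centralizer S 1.
Proof. by move=> s _; rewrite mul1r mulr1. Qed.

Lemma centralizerN S z : centralizer S z -> centralizer S (- z).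
Proof. by move=> cz s Ss; rewrite mulNr mulrN cz. Qed.

Lemma centralizerB S y z : centralizer S y -> centralizer S z -> centralizer S (y - z).
Proof. by case: (centralizer_division_subring S) => _ _ CB _ _; exact: CB. Qed.

Lemma centralizerM S y z : centralizer S y -> centralizer S z -> centralizer S (y * z).
Proof. by case: (centralizer_division_subring S) => _ _ _ CM _; exact: CM. Qed.

Lemma central_centralizer z : central_in B z -> centralizer B z.
Proof. by move=> [_ cz] c Bc; rewrite cz. Qed.

(** Conjugation by [b] multiplies [a * a] by the square of the central element [conj_ratio a b]. *)
Lemma conj_ratio_sq a b : B a -> B b -> b * (a * a) = a * a * b ->
  conj_ratio a b = 1 \/ conj_ratio a b = - 1.
Proof.
move=> Ba Bb ab; have Wa := conj_ratio_weight Ba Bb.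
have [_ Ca] := conj_ratio_central Ba Bb.
move: (conj_ratio a b) Wa Ca => y Wa Ca; apply: div_sq_eq1.
have aU := divD (BU (BM Ba Ba)); have bU := divD (BU Bb).
apply: (mulIr aU); apply: (mulIr bU); rewrite mul1r -ab (mulrA b) Wa.
by rewrite -(mulrA _ b a) Wa !mulrA -(mulrA y a y) (Ca a Ba) !mulrA.
Qed.

(** With [be] central in [B], the relation involves only the characters [Y = conj_ratio ga], [Y^2]
    and [1], and [b] separates [Y] from the other two. The vanishing [Y]-term gives [be * be = 1],
    so [be = - 1]; the rest then gives [y * (ga * ga) = 1], whence [y = - 1], [ga * ga = - 1] and
    [h = ga]. *)
Lemma twisted_central h b be ga : twisted h b be ga -> centralizer B be ->
  [/\ ga = h, h * h = - 1, b * h = - (h * b) & b * h <> h * b].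
Proof.
move=> tw cbe; have [[Bb Bbe Bga] _ _ hb] := tw.
have [bek diff _ _ kh] := twisted_conj tw.
have := twisted_relation tw; rewrite /= (conj_ratio_eq1 Bbe cbe Bb).
have := twisted_nontrivial tw; rewrite (conj_ratio_eq1 Bbe cbe Bb).
have Yc := conj_ratio_central Bga; have Yw := conj_ratio_weight Bga.
have [yb ybE] : exists y, conj_ratio ga b = y by eexists.
move: (Yc b Bb) (Yw b Bb); rewrite ybE; move: yb ybE => y ybE cy yw y1 rel.
have {}y1 : y <> 1 by move=> y1'; apply: y1.
have Cy := central_centralizer cy.
have yU : y \is a GRing.unit by apply/divD/BU; case: cy.
have yy : y * y <> y by move=> yy; apply: y1; apply: (mulrI yU); rewrite mulr1.
have Cbb := centralizerM cbe cbe; have C1 := @centralizer1 B.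
have r0 : y * (be * be - 1) * ga = 0.
  apply: (weight_indep (Q := [::
    (fun b => conj_ratio ga b * conj_ratio ga b, y * (1 - be) * (ga * ga));
    (fun=> 1, be - be * be)]) grB Yc).
  - apply: weightMl; [|exact: Yc|exact: Yw].
    by apply: centralizerM => //; exact: centralizerB.
  - do !apply: List.Forall_cons => //=; split=> //; try by exists b; rewrite ?ybE //.
    + exact: central_in_char.
    + apply: weightMl; last by apply: weightM.
        by apply: centralizerM => //; exact: centralizerB.
      exact: central_in_char.
    + by exists b => //; rewrite ybE; exact: nesym.
    + exact: central_char1.
    + by apply: weight1; exact: centralizerB.
  - rewrite !big_cons big_nil /= addr0 -[RHS]rel; move: (cbe _ Bga) => bg.
    have -> : ga * (be * be) = be * be * ga by rewrite mulrA -bg -!mulrA -bg.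
    have -> : ga * ga * be = be * ga * ga by rewrite -mulrA -bg mulrA -bg.
    by non_commutative_ring.
have {r0} be1 : be = - 1.
  have : be * be = 1.
    case/div_mul_eq0: r0 => [/div_mul_eq0 [y0|/eqP]|ga0].
    - by move: yU; rewrite y0 unitr0.
    - by rewrite subr_eq0 => /eqP.
    - by have := BU Bga; rewrite ga0 eqxx.
  by case/div_sq_eq1 => // be1; case: kh; rewrite -[RHS]bek be1 mul1r.
(* In characteristic 2, [be = - 1] would equal [1], and [k = h] would follow. *)
have n2 : (1 + 1 : D) != 0.
  apply/eqP=> n2; apply: kh; rewrite -[RHS]bek be1.
  have -> : (- 1 : D) = 1 by apply/eqP; rewrite eq_sym -addr_eq0 n2.
  by rewrite mul1r.
have ygg : y * (ga * ga) = 1.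
  have : (1 + 1) * (y * (ga * ga) - 1) = 0.
    by rewrite -[RHS]rel be1; non_commutative_ring.
  by case/div_mul_eq0 => /eqP; rewrite ?(negPf n2) // subr_eq0 => /eqP.
have gg1 : ga * ga = y^-1 by apply: (mulrI yU); rewrite ygg mulrV.
have yN1 : y = - 1.
  have [] := conj_ratio_sq Bga Bb; rewrite ?ybE // gg1.
  by apply: commrV; exact: esym (Cy b Bb).
have ggN1 : ga * ga = - 1 by rewrite gg1 yN1 invrN1.
have gaN1 : 1 + ga != 0.
  apply/eqP=> g1; move: yw; have -> : ga = - 1.
    by apply/eqP; rewrite -addr_eq0 addrC g1.
  move/eqP; rewrite -subr_eq0 yN1.
  have -> : b * -1 - -1 * -1 * b = - ((1 + 1) * b) by non_commutative_ring.
  by rewrite oppr_eq0 => /eqP /div_mul_eq0 [] /eqP; [rewrite (negPf n2) | rewrite (negPf (BU Bb))].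
have kE : b * h * b^-1 = - ga.
  apply: (mulrI (divD gaN1)); move: diff; rewrite be1.
  have -> : (-1 - ga) * (b * h / b) = - ((1 + ga) * (b * h / b)) by non_commutative_ring.
  move/eqP; rewrite eqr_oppLR => /eqP ->.
  have -> : (1 + ga) * - ga = - ga - ga * ga by non_commutative_ring.
  by rewrite ggN1; non_commutative_ring.
have gah : ga = h by rewrite -[RHS]bek be1 kE; non_commutative_ring.
split=> //; [by rewrite -gah| |exact: nesym].
by rewrite -gah yw yN1; non_commutative_ring.
Qed.

(** Contrapositive of [weight_indep]: a term whose character no other term shares must vanish. *)
Lemma weight_collision lam r (Q : seq ((D -> D) * D)) :
  central_char B lam -> weight B lam r ->
  List.Forall (fun q => central_char B q.1 /\ weight B q.1 q.2) Q ->
  r <> 0 -> r + \sum_(q <- Q) q.2 = 0 ->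
  List.Exists (fun q => forall b, B b -> lam b = q.1 b) Q.
Proof.
move=> cl wr FQ r0 sum0; apply: NNPP => /List.Forall_Exists_neg nE.
apply: r0; apply: (weight_indep grB cl wr _ sum0).
elim: Q FQ nE {sum0} => [|q Q IHQ] // /List.Forall_cons_iff [[cq wq] FQ].
move=> /List.Forall_cons_iff [nq nQ]; apply: List.Forall_cons; last exact: IHQ.
split=> //; apply: NNPP => ne; apply: nq => b Bb.
by apply: NNPP => neb; apply: ne; exists b.
Qed.

(** * The case of three distinct characters *)

Section Generic.
Variables (h b be ga : D).
Hypothesis tw : twisted h b be ga.
Local Notation X := (conj_ratio be).
Local Notation Y := (conj_ratio ga).
Local Notation x := (conj_ratio be b).
Local Notation y := (conj_ratio ga b).
Hypothesis nX : exists2 c, B c & X c <> 1.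
Hypothesis nY : exists2 c, B c & Y c <> 1.
Hypothesis nXY : exists2 c, B c & X c <> Y c.

Let Bb : B b. Proof. by case: tw => [[]]. Qed.
Let Bbe : B be. Proof. by case: tw => [[]]. Qed.
Let Bga : B ga. Proof. by case: tw => [[]]. Qed.
Let cX : central_char B X := conj_ratio_central Bbe.
Let cY : central_char B Y := conj_ratio_central Bga.
Let wX : weight B X be := conj_ratio_weight Bbe.
Let wY : weight B Y ga := conj_ratio_weight Bga.
Let xC : centralizer B x := central_centralizer (cX Bb).
Let yC : centralizer B y := central_centralizer (cY Bb).
Let cXX : central_char B (fun c => X c * X c) := central_in_char cX cX.
Let cYY : central_char B (fun c => Y c * Y c) := central_in_char cY cY.
Let cYXX : central_char B (fun c => Y c * (X c * X c)) := central_in_char cY cXX.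
Let cYYX : central_char B (fun c => Y c * Y c * X c) := central_in_char cYY cX.
Let wXX : weight B (fun c => X c * X c) (be * be) := weightM cX Bbe wX wX.
Let wYY : weight B (fun c => Y c * Y c) (ga * ga) := weightM cY Bga wY wY.
(** [w1] to [w6] record the characters of the six terms of [twisted_relation], in their order. *)
Let w1 : weight B (fun c => Y c * (X c * X c)) (x * y * (ga * (be * be))).
Proof. by apply: weightMl; [exact: centralizerM|exact: cYXX|exact: weightM]. Qed.
Let w2 : weight B (fun c => Y c * Y c * X c) (- (x * y * (ga * ga * be))).
Proof.
rewrite -mulNr; apply: weightMl; [|exact: cYYX|exact: weightM cX (BM Bga Bga) wYY wX].
by apply: centralizerN; exact: centralizerM.
Qed.
Let w3 : weight B (fun c => X c * X c) (- (x * (be * be))).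
Proof. by rewrite -mulNr; apply: weightMl => //; exact: centralizerN. Qed.
Let w4 : weight B X (x * be).
Proof. exact: weightMl. Qed.
Let w5 : weight B (fun c => Y c * Y c) (y * (ga * ga)).
Proof. exact: weightMl. Qed.
Let w6 : weight B Y (- (y * ga)).
Proof. by rewrite -mulNr; apply: weightMl => //; exact: centralizerN. Qed.
Let rel := twisted_relation tw.
Let xy1 : ~ (x = 1 /\ y = 1) := twisted_nontrivial tw.

Let XU c : B c -> X c \is a GRing.unit.
Proof. by move=> Bc; apply/divD/BU; case: (cX Bc). Qed.
Let YU c : B c -> Y c \is a GRing.unit.
Proof. by move=> Bc; apply/divD/BU; case: (cY Bc). Qed.
Let XYC c : B c -> X c * Y c = Y c * X c.
Proof. by move=> Bc; case: (cY Bc) => _; apply; case: (cX Bc). Qed.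

Let be_sq : be * be <> 1.
Proof.
case: nX => c Bc Xc /div_sq_eq1 be1; apply: Xc; apply: conj_ratio_eq1 => //.
by case: be1 => ->; [|apply: centralizerN]; exact: centralizer1.
Qed.

Let ga_sq : ga * ga <> 1.
Proof.
case: nY => c Bc Yc /div_sq_eq1 ga1; apply: Yc; apply: conj_ratio_eq1 => //.
by case: ga1 => ->; [|apply: centralizerN]; exact: centralizer1.
Qed.

Let be_ga_sq : be * ga = ga * be -> be * be <> ga * ga.
Proof.
move=> bg; case: nXY => c Bc Xc /(div_sq_eq bg) [] bega; apply: Xc; rewrite bega //.
exact: conj_ratioN.
Qed.

(** The product [ga * be] has trivial character, hence commutes with [ga]. *)
Let commute_of_inverse : (forall c, B c -> Y c * X c = 1) -> be * ga = ga * be.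
Proof.
move=> YX1; have cgb : weight B (fun=> 1) (ga * be).
  by apply: weight_eq (weightM cX Bga wY wX) _ => c Bc; exact: YX1.
have := cgb _ Bga; rewrite mul1r -!mulrA => /(mulrI (divD (BU Bga))).
by move=> /esym.
Qed.

Let xU : x \is a GRing.unit := XU Bb.
Let yU : y \is a GRing.unit := YU Bb.
Let beU : be \is a GRing.unit := divD (BU Bbe).
Let gaU : ga \is a GRing.unit := divD (BU Bga).

Let x_ga : x * y * (ga * (be * be)) = y * ga * (x * (be * be)).
Proof. by rewrite !mulrA -(mulrA y ga x) -(xC Bga) !mulrA (XYC Bb). Qed.

(* When the characters [1], [X], [Y] are distinct, each of the six terms of
   [rel] must share its character with another one.  This leaves the cases
   where [X] and [Y] span a cyclic group of order 3 or 4, or a Klein group. *)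
Lemma cyclic4_sqX_impossible :
  (forall c, B c -> X c * X c = Y c) -> (forall c, B c -> Y c * Y c = 1) -> False.
Proof.
move=> XX YY.
have [] := weight_indep3 (r1 := - (x * y * (ga * ga * be)) + x * be)
  (r2 := - (x * (be * be)) + - (y * ga))
  (r3 := x * y * (ga * (be * be)) + y * (ga * ga))
  grB cX cY central_char1 _ _ _ nXY nX nY.
- apply: weightD w4; apply: weight_eq w2 _ => c Bc; by rewrite YY ?mul1r.
- by apply: weightD w6; apply: weight_eq w3 _.
- by apply: weightD; [apply: weight_eq w1 _ => c Bc; rewrite XX ?YY | apply: weight_eq w5 _].
- by rewrite -rel; non_commutative_ring.
(* [eX] gives [y * (ga * ga) = 1] and [eY] gives [x * (be * be) = - (y * ga)]; inserted in [e1] they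
   force [y = 1], so [ga * ga = 1]. *)
move=> eX eY e1.
have ygg1 : y * (ga * ga) = 1.
  apply: (mulIr beU); apply: (mulrI xU); apply/esym/eqP; rewrite mul1r -subr_eq0.
  by rewrite -eX !mulrA addrC.
have xbb : x * (be * be) = - (y * ga).
  by apply/eqP; rewrite eq_sym -subr_eq0 -eY; apply/eqP; non_commutative_ring.
have y1 : y = 1.
  apply/esym/eqP; rewrite -subr_eq0 -e1 x_ga xbb ygg1.
  have -> : y * ga * - (y * ga) = - (y * (ga * y * ga)) by non_commutative_ring.
  by rewrite -(yC Bga) -(mulrA y ga) ygg1 mulr1 addrC.
by apply: ga_sq; rewrite -ygg1 y1 mul1r.
Qed.

(** The same pattern with [Y] of order 4: [x * (be * be) = 1] and [y * (ga * ga) = - (x * be)] force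
    [x = 1], so [be * be = 1]. *)
Lemma cyclic4_sqY_impossible :
  (forall c, B c -> Y c * Y c = X c) -> (forall c, B c -> X c * X c = 1) -> False.
Proof.
move=> YY XX.
have [] := weight_indep3 (r1 := x * be + y * (ga * ga))
  (r2 := x * y * (ga * (be * be)) + - (y * ga))
  (r3 := - (x * y * (ga * ga * be)) + - (x * (be * be)))
  grB cX cY central_char1 _ _ _ nXY nX nY.
- by apply: weightD w4 _; apply: weight_eq w5 _.
- by apply: weightD w6; apply: weight_eq w1 _ => c Bc; rewrite XX ?mulr1.
- by apply: weightD; [apply: weight_eq w2 _ => c Bc; rewrite YY ?XX | apply: weight_eq w3 _].
- by rewrite -rel; non_commutative_ring.
move=> eX eY e1.
have xbb : x * (be * be) = 1.
  apply: (mulrI gaU); apply: (mulrI yU); apply/eqP; rewrite mulr1 -subr_eq0.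
  by rewrite -eY x_ga !mulrA.
have ygg : y * (ga * ga) = - (x * be).
  by apply/eqP; rewrite eq_sym -subr_eq0; rewrite -oppr_eq0 -eX; apply/eqP; non_commutative_ring.
have x1 : x = 1.
  apply/eqP; rewrite -subr_eq0 -e1 xbb -!mulrA (mulrA ga ga) (mulrA y) ygg.
  have -> : - (x * (- (x * be) * be)) = x * (x * (be * be)) by non_commutative_ring.
  by rewrite xbb mulr1.
by apply: be_sq; rewrite -xbb x1 mul1r.
Qed.

(** Here [be] and [ga] commute. The parts at [X] and [Y] give [y * (ga * be) = - 1] and [x = y]; the
    part at [X^2] then gives [be * be = ga * ga], so [be] is [ga] or [- ga] and [X = Y]. *)
Lemma cyclic4_inverse_impossible :
  (forall c, B c -> Y c * X c = 1) -> (forall c, B c -> X c * X c = Y c * Y c) -> False.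
Proof.
move=> YX XX.
have [] := weight_indep3 (r1 := x * y * (ga * (be * be)) + x * be)
  (r2 := - (x * y * (ga * ga * be)) + - (y * ga))
  (r3 := - (x * (be * be)) + y * (ga * ga))
  grB cX cY cXX _ _ _ nXY.
- by apply: weightD w4; apply: weight_eq w1 _ => c Bc; rewrite mulrA YX ?mul1r.
- by apply: weightD w6; apply: weight_eq w2 _ => c Bc; rewrite -mulrA YX ?mulr1.
- by apply: weightD w3 _; apply: weight_eq w5 _ => c Bc; rewrite XX.
- case: nX => c Bc Xc; exists c => // XXc; apply: Xc.
  by apply: (mulrI (XU Bc)); rewrite -XXc mulr1.
- case: nY => c Bc Yc; exists c => //; rewrite XX // => YYc; apply: Yc.
  by apply: (mulrI (YU Bc)); rewrite -YYc mulr1.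
- by rewrite -rel; non_commutative_ring.
move=> eX eY e3; have bg := commute_of_inverse YX.
have ygb : y * (ga * be) = - 1.
  apply: (mulIr beU); apply: (mulrI xU); apply/eqP; rewrite -subr_eq0.
  rewrite -eX; apply/eqP; non_commutative_ring.
have xy : x = y.
  apply: (mulIr gaU); apply/eqP; rewrite -subr_eq0 -eY.
  have -> : x * y * (ga * ga * be) = x * (y * (ga * be)) * ga.
    by rewrite -!mulrA bg.
  by rewrite ygb; apply/eqP; non_commutative_ring.
apply: (be_ga_sq bg); apply: (mulrI yU); apply/eqP; rewrite eq_sym -subr_eq0.
by rewrite -e3 xy addrC.
Qed.

(** Here [be] and [ga] commute, and [x] is a primitive cube root of unity. For [s = y * ga] and
    [p = s * be], the two halves of the relation express [s^3] and [be^3] as polynomials in [p];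
    then [p^3 = s^3 * be^3] becomes [(p - x^2)^2 = 0]. Hence [be^3 = 1], so [be] is a power of [x]
    and central in [B], against [nX]. *)
Lemma cyclic3_impossible :
  (forall c, B c -> X c * X c = Y c) -> (forall c, B c -> Y c * X c = 1) -> False.
Proof.
move=> XX YX.
have YY c : B c -> Y c * Y c = X c.
  by move=> Bc; rewrite -{2}(XX c Bc) mulrA YX ?mul1r.
set r1 := x * y * (ga * (be * be)) + x * be + y * (ga * ga).
set r2 := - (x * y * (ga * ga * be)) + - (x * (be * be)) + - (y * ga).
have w_r1 : weight B X r1.
  apply: weightD; [apply: weightD w4|].
    by apply: weight_eq w1 _ => c Bc; rewrite mulrA YX ?mul1r.
  exact: weight_eq w5 _.
have w_r2 : weight B Y r2.
  apply: weightD w6; apply: weightD; last exact: weight_eq w3 _.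
  by apply: weight_eq w2 _ => c Bc; rewrite -mulrA YX ?mulr1.
have sum0 : r1 + r2 = 0 by rewrite -[RHS]rel /r1 /r2; non_commutative_ring.
have r10 : r1 = 0.
  apply: (weight_indep (Q := [:: (Y, r2)]) grB cX w_r1).
    by do !apply: List.Forall_cons => //.
  by rewrite big_seq1.
have r20 : r2 = 0 by move: sum0; rewrite r10 add0r.
have bg := commute_of_inverse YX.
have [yx1 xx] := (YX b Bb, XX b Bb).
have xy_1 : x * y = 1 by rewrite XYC.
have [xb xg] := (xC Bbe, xC Bga).
have x1 : x <> 1 by move=> x1; apply: xy1; rewrite -xx x1 mulr1.
have x3 : x * x * x = 1 by rewrite xx.
have xsum : x * x = - x - 1.
  have : (x - 1) * (x * x + x + 1) = 0.
    have -> : (x - 1) * (x * x + x + 1) = x * x * x - 1 by non_commutative_ring.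
    by rewrite x3 subrr.
  case/div_mul_eq0=> [/eqP|e]; first by rewrite subr_eq0 => /eqP.
  by apply/eqP; rewrite -subr_eq0 -e; apply/eqP; non_commutative_ring.
pose s := y * ga; have gaE : ga = x * s by rewrite /s mulrA xy_1 mul1r.
have xs : x * s = s * x by rewrite /s mulrA xy_1 mul1r -mulrA -xg mulrA yx1 mul1r.
have bs : be * s = s * be.
  by rewrite /s mulrA -(yC Bbe) -!mulrA bg.
have sU : s \is a GRing.unit by rewrite /s unitrMl.
pose p := s * be.
have xp : x * p = p * x by rewrite /p mulrA xs -mulrA xb mulrA.
have pU : p \is a GRing.unit by rewrite /p unitrMl.
have ys : y * ga = s by [].
clearbody s.
have e1 : s * (be * be) + be + s * s = 0.
  apply: (mulrI xU); rewrite mulr0 -r10 /r1 xy_1 mul1r (mulrA y) ys gaE.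
  by rewrite (mulrA s x s) -xs; non_commutative_ring.
have e2 : x * (s * s) * be + be * be + x * x * s = 0.
  apply: (mulrI xU); rewrite mulr0 -[RHS]oppr0 -r20 /r2 xy_1 mul1r ys gaE.
  transitivity (x * x * s * s * be + x * be * be + x * x * x * s).
    by non_commutative_ring.
  have -> : x * s * (x * s) = x * x * s * s by rewrite !mulrA -(mulrA x s) -xs !mulrA.
  by rewrite x3; non_commutative_ring.
have p2 : p * p = s * s * (be * be) by rewrite /p !mulrA -(mulrA s be) bs !mulrA.
have s3 : s * s * s = - (p * p + p).
  apply/eqP; rewrite -addr_eq0 -[X in _ == X](mulr0 s) -e1 p2 /p; apply/eqP.
  by non_commutative_ring.
have b3 : be * be * be = - (x * (p * p) + x * x * p).
  apply/eqP; rewrite -addr_eq0 -[X in _ == X](mul0r be) -e2 p2 /p; apply/eqP.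
  by non_commutative_ring.
have p3 : p * (p * p) = s * s * s * (be * be * be).
  rewrite p2 /p -!mulrA; congr (s * _); rewrite !mulrA bs.
  by rewrite -(mulrA s be s) bs !mulrA.
have pE : p = (p + 1) * (x * p + x * x).
  have cpp : p * x = x * p by [].
  have : p * (p * p) = p * (p * ((p + 1) * (x * p + x * x))).
    rewrite p3 s3 b3.
    transitivity ((p * p + p) * ((x * p + x * x) * p)); first by non_commutative_ring.
    have -> : (x * p + x * x) * p = p * (x * p + x * x).
      by rewrite mulrDl mulrDr !mulrA cpp -(mulrA x p x) cpp !mulrA.
    by non_commutative_ring.
  by move=> /(mulrI pU) /(mulrI pU).
have q0 : x * (p * p) - p - p + x * x = 0.
  have -> : x * (p * p) - p - p + x * x
      = (p + 1) * (x * p + x * x) - p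
        + (x * p - p * x) * p + (x * p - p * x) * x + x * (x * p - p * x)
        - (x * x + x + 1) * p by non_commutative_ring.
  by rewrite -pE xsum xp; non_commutative_ring.
have pxx : p = x * x.
  have : (p - x * x) * (p - x * x) = 0.
    have -> : (p - x * x) * (p - x * x) = x * x * (x * (p * p) - p - p + x * x)
      + (x * p - p * x) * x + x * (x * p - p * x) + (1 - x * x * x) * (p * p)
      + (x * x * x - x * x * x) * x by non_commutative_ring.
    by rewrite q0 xp x3 !subrr; non_commutative_ring.
  by case/div_mul_eq0 => /eqP; rewrite subr_eq0 => /eqP.
have {}b3 : be * be * be = 1.
  rewrite b3 pxx.
  have -> : x * (x * x * (x * x)) + x * x * (x * x) = x * x * x * (x * x) + x * x * x * x.
    by non_commutative_ring.
  by rewrite x3 !mul1r xsum; non_commutative_ring.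
have : (be - 1) * ((be - x) * (be - x * x)) = 0.
  pose c := x * be - be * x; have c0 : c = 0 by rewrite /c xb subrr.
  have -> : (be - 1) * ((be - x) * (be - x * x)) = be * be * be - 1
    - (x * x + x + 1) * (be * be - be) + (x * x * x - 1) * (be - 1)
    + (x * c + c * x + c) * be - (x * x * c + x * c * x + c * x * x)
    + (be - 1) * (x * c + c * x) by rewrite /c; non_commutative_ring.
  by rewrite c0 b3 x3 xsum; non_commutative_ring.
have notC z : centralizer B z -> be <> z.
  by move=> Cz bez; case: nX => c Bc; apply; apply: conj_ratio_eq1 => //; rewrite bez.
case/div_mul_eq0 => [|/div_mul_eq0 []] /eqP; rewrite subr_eq0 => /eqP; apply: notC => //.
- exact: centralizer1.
- exact: centralizerM.
Qed.

(** The relation splits at [X], [Y] and [1], which yields [x = y = - 1] and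
    [be * be = ga * ga = - 1]; commuting [be] and [ga] would then agree up to sign. Finally
    [h + h = - (1 + w)] with [w = be - ga + be * ga] and [w * w = - 3]. *)
Lemma klein_quaternion :
  (forall c, B c -> X c * X c = 1) -> (forall c, B c -> Y c * Y c = 1) ->
  [/\ be * be = - 1, ga * be = - (be * ga), ga * be <> be * ga & h * h + h + 1 = 0].
Proof.
move=> XX YY.
have [] := weight_indep3 (r1 := - (x * y * (ga * ga * be)) + x * be)
  (r2 := x * y * (ga * (be * be)) + - (y * ga))
  (r3 := - (x * (be * be)) + y * (ga * ga))
  grB cX cY central_char1 _ _ _ nXY nX nY.
- by apply: weightD w4; apply: weight_eq w2 _ => c Bc; rewrite YY ?mul1r.
- by apply: weightD w6; apply: weight_eq w1 _ => c Bc; rewrite XX ?mulr1.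
- by apply: weightD; [apply: weight_eq w3 _ | apply: weight_eq w5 _].
- by rewrite -rel; non_commutative_ring.
move=> eX eY e1.
have xbb : x * (be * be) = 1.
  apply: (mulrI gaU); apply: (mulrI yU); apply/eqP; rewrite mulr1 -subr_eq0.
  by rewrite -eY x_ga !mulrA.
have ygg : y * (ga * ga) = 1.
  by rewrite -[RHS]xbb; apply/eqP; rewrite -subr_eq0 -e1 addrC.
have xN1 : x = - 1.
  by case/div_sq_eq1: (XX b Bb) => // x1; case: be_sq; rewrite -xbb x1 mul1r.
have yN1 : y = - 1.
  by case/div_sq_eq1: (YY b Bb) => // y1; case: ga_sq; rewrite -ygg y1 mul1r.
have bb : be * be = - 1 by apply: oppr_inj; rewrite opprK -mulN1r -xN1 xbb.
have gg : ga * ga = - 1 by apply: oppr_inj; rewrite opprK -mulN1r -yN1 ygg.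
have gb : ga * be = - (be * ga).
  have := wY Bbe; case/div_sq_eq1: (YY be Bbe) => ->; last first.
    by move=> ->; non_commutative_ring.
  by rewrite mul1r => bg; case: (be_ga_sq bg); rewrite bb gg.
have n2 : (1 + 1 : D) != 0.
  apply/eqP=> n2; apply: xy1; rewrite xN1 yN1.
  by split; apply/eqP; rewrite eq_sym -addr_eq0 n2.
have gb_ne : ga * be <> be * ga.
  rewrite gb => /eqP; rewrite eq_sym -addr_eq0.
  have -> : be * ga + be * ga = (1 + 1) * (be * ga) by non_commutative_ring.
  case/eqP/div_mul_eq0=> [/eqP|/eqP]; rewrite ?(negPf n2) //.
  by rewrite (negPf (BU (BM Bbe Bga))).
split=> //; have [bek diff _ _ _] := twisted_conj tw.
move: (b * h * b^-1) bek diff => k bek diff.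
(* By anticommutation [(be - ga)^2 = - 2], so multiplying [diff] by [be - ga] determines [k + k]. *)
have k2 : k + k = - (be * ga - be + 1 + ga).
  have : (be - ga) * ((be - ga) * k) = - (k + k).
    have -> : (be - ga) * ((be - ga) * k)
      = (be * be + ga * ga - (be * ga + ga * be)) * k by non_commutative_ring.
    by rewrite bb gg gb; non_commutative_ring.
  rewrite diff => /(congr1 (@GRing.opp D)); rewrite opprK => <-.
  have -> : (be - ga) * (ga - 1) = be * ga - be - ga * ga + ga by non_commutative_ring.
  by rewrite gg; non_commutative_ring.
pose w := be - ga + be * ga.
have h2 : h + h = - (1 + w).
  rewrite -bek -mulrDr k2 /w.
  have -> : be * - (be * ga - be + 1 + ga) = - (be * be * ga - be * be + be + be * ga).
    by non_commutative_ring.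
  by rewrite bb; non_commutative_ring.
have ww : w * w = - (1 + 1 + 1).
  have -> : w * w = be * be + ga * ga - (be * ga + ga * be) + be * be * ga
    + be * (ga * be) - ga * be * ga - be * (ga * ga) + be * (ga * be) * ga.
    by rewrite /w; non_commutative_ring.
  rewrite gb.
  have -> : be * - (be * ga) = - (be * be * ga) by non_commutative_ring.
  have -> : - (be * ga) * ga = - (be * (ga * ga)) by non_commutative_ring.
  have -> : - (be * be * ga) * ga = - (be * be * (ga * ga)) by non_commutative_ring.
  by rewrite bb gg; non_commutative_ring.
have : (1 + 1) * ((1 + 1) * (h * h + h + 1)) = 0.
  transitivity ((h + h) * (h + h) + (1 + 1) * (h + h) + (1 + 1) * (1 + 1)).
    by non_commutative_ring.
  rewrite h2; transitivity (w * w + (1 + 1 + 1)); first by non_commutative_ring.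
  by rewrite ww addNr.
by case/div_mul_eq0 => [/eqP|/div_mul_eq0 [/eqP|//]]; rewrite (negPf n2).
Qed.

Let unit_neq0 z : z \is a GRing.unit -> z <> 0.
Proof. by move=> zU z0; rewrite z0 unitr0 in zU. Qed.

Let no_eqXY (f : D -> D) : (forall c, B c -> f c \is a GRing.unit) ->
  ~ (forall c, B c -> f c * X c = f c * Y c).
Proof.
by move=> fU fXY; case: nXY => c Bc; apply; apply: (mulrI (fU c Bc)); exact: fXY.
Qed.

Let no_eqX1 (f : D -> D) : (forall c, B c -> f c \is a GRing.unit) ->
  ~ (forall c, B c -> f c * X c = f c).
Proof.
by move=> fU fX; case: nX => c Bc; apply; apply: (mulrI (fU c Bc)); rewrite mulr1 fX.
Qed.

Let no_eqY1 (f : D -> D) : (forall c, B c -> f c \is a GRing.unit) ->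
  ~ (forall c, B c -> f c * Y c = f c).
Proof.
by move=> fU fY; case: nY => c Bc; apply; apply: (mulrI (fU c Bc)); rewrite mulr1 fY.
Qed.

(** The term [- (y * ga)] is nonzero, so its character [Y] recurs among the other five; two of these
    coincidences would make [Y] equal to [X] or to [1]. The next two statements treat [x * be] and
    [- (x * (be * be))] alike. *)
Let collision_ga :
  [\/ forall c, B c -> X c * X c = 1, forall c, B c -> Y c * X c = 1
    | forall c, B c -> X c * X c = Y c].
Proof.
unshelve epose proof (weight_collision (Q := [::
  (fun c => Y c * (X c * X c), x * y * (ga * (be * be)));
  (fun c => Y c * Y c * X c, - (x * y * (ga * ga * be)));
  (fun c => X c * X c, - (x * (be * be))); (X, x * be);
  (fun c => Y c * Y c, y * (ga * ga))]) cY w6 _ _ _) as coll.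
- by do !apply: List.Forall_cons => //.
- by apply: unit_neq0; rewrite unitrN unitrMl.
- by rewrite !big_cons big_nil /= -[RHS]rel; non_commutative_ring.
move: coll => /List.Exists_cons [/= e|].
  by apply: Or31 => c Bc; apply: (mulrI (YU Bc)); rewrite mulr1 -e.
move=> /List.Exists_cons [/= e|].
  by apply: Or32 => c Bc; apply: (mulrI (YU Bc)); rewrite mulr1 mulrA -e.
move=> /List.Exists_cons [/= e|]; first by apply: Or33 => c Bc; rewrite e.
move=> /List.Exists_cons [/= e|].
  by case: (@no_eqXY (fun=> 1)) => [c _|c Bc]; rewrite ?unitr1 // e.
move=> /List.Exists_cons [/= e|/List.Exists_nil //].
by case: (no_eqY1 YU) => c Bc; rewrite -e.
Qed.

Let collision_be :
  [\/ forall c, B c -> Y c * X c = 1, forall c, B c -> Y c * Y c = 1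
    | forall c, B c -> Y c * Y c = X c].
Proof.
unshelve epose proof (weight_collision (Q := [::
  (fun c => Y c * (X c * X c), x * y * (ga * (be * be)));
  (fun c => Y c * Y c * X c, - (x * y * (ga * ga * be)));
  (fun c => X c * X c, - (x * (be * be)));
  (fun c => Y c * Y c, y * (ga * ga)); (Y, - (y * ga))]) cX w4 _ _ _) as coll.
- by do !apply: List.Forall_cons => //.
- by apply: unit_neq0; rewrite unitrMl.
- by rewrite !big_cons big_nil /= -[RHS]rel; non_commutative_ring.
move: coll => /List.Exists_cons [/= e|].
  by apply: Or31 => c Bc; apply: (mulIr (XU Bc)); rewrite mul1r -mulrA -e.
move=> /List.Exists_cons [/= e|].
  by apply: Or32 => c Bc; apply: (mulIr (XU Bc)); rewrite mul1r -e.
move=> /List.Exists_cons [/= e|].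
  by case: (no_eqX1 XU) => c Bc; rewrite -e.
move=> /List.Exists_cons [/= e|]; first by apply: Or33 => c Bc; rewrite e.
move=> /List.Exists_cons [/= e|/List.Exists_nil //].
by case: (@no_eqXY (fun=> 1)) => [c _|c Bc]; rewrite ?unitr1 // e.
Qed.

Let collision_be2 :
  [\/ forall c, B c -> Y c * Y c = X c, forall c, B c -> X c * X c = Y c * Y c
    | forall c, B c -> X c * X c = Y c].
Proof.
unshelve epose proof (weight_collision (Q := [::
  (fun c => Y c * (X c * X c), x * y * (ga * (be * be)));
  (fun c => Y c * Y c * X c, - (x * y * (ga * ga * be)));
  (X, x * be); (fun c => Y c * Y c, y * (ga * ga)); (Y, - (y * ga))]) cXX w3 _ _ _) as coll.
- by do !apply: List.Forall_cons => //.
- by apply: unit_neq0; rewrite unitrN !unitrMl.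
- by rewrite !big_cons big_nil /= -[RHS]rel; non_commutative_ring.
move: coll => /List.Exists_cons [/= e|].
  case: (@no_eqY1 (fun c => X c * X c)) => [c Bc|c Bc].
    by rewrite unitrMl; exact: XU.
  by rewrite [RHS]e // -mulrA XYC // mulrA XYC // mulrA.
move=> /List.Exists_cons [/= e|].
  by apply: Or31 => c Bc; apply: (mulIr (XU Bc)); rewrite -e.
move=> /List.Exists_cons [/= e|].
  by case: (no_eqX1 XU) => c Bc; rewrite e.
move=> /List.Exists_cons [/= e|]; first by apply: Or32.
by move=> /List.Exists_cons [/= e|/List.Exists_nil //]; apply: Or33.
Qed.

(** Combining the collisions leaves cyclic cases of order 3 and 4, all excluded above, and the Klein
    case. *)
Lemma generic_quaternion :
  [/\ be * be = - 1, ga * be = - (be * ga), ga * be <> be * ga & h * h + h + 1 = 0].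
Proof.
have invX : (forall c, B c -> Y c * X c = 1) -> ~ (forall c, B c -> X c * X c = 1).
  move=> YX XX; apply: (@no_eqXY (fun=> 1)) => [c _|c Bc]; first exact: unitr1.
  by apply: (mulIr (XU Bc)); rewrite !mul1r XX ?YX.
have invXX : (forall c, B c -> Y c * X c = 1) ->
    (forall c, B c -> Y c * Y c = X c) -> forall c, B c -> X c * X c = Y c.
  by move=> YX YY c Bc; rewrite -{1}YY // -mulrA YX // mulr1.
case: collision_ga => [XX|YX|XX].
- case: collision_be => [YX|YY|YY]; first by case: (invX YX XX).
    exact: klein_quaternion.
  by case: (cyclic4_sqY_impossible YY XX).
- exfalso; case: collision_be2 => [YY|XX|XX].
  + exact: cyclic3_impossible (invXX YX YY) YX.
  + exact: cyclic4_inverse_impossible YX XX.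
  + exact: cyclic3_impossible XX YX.
- exfalso; case: collision_be => [YX|YY|YY].
  + exact: cyclic3_impossible XX YX.
  + exact: cyclic4_sqX_impossible XX YY.
  + apply: (cyclic3_impossible XX) => c Bc; apply: (mulIr (XU Bc)).
    by rewrite mul1r -mulrA XX // YY.
Qed.

End Generic.

(** * Coinciding characters and exceptional elements *)

Lemma conj_ratio1_central a :
  B a -> (forall c, B c -> conj_ratio a c = 1) -> centralizer B a.
Proof.
by move=> Ba a1 c Bc; have := conj_ratio_weight Ba Bc; rewrite a1 // mul1r => ->.
Qed.

Lemma conj_ratio_eq_central a c : B a -> B c ->
  (forall e, B e -> conj_ratio a e = conj_ratio c e) -> centralizer B (c * a^-1).
Proof.
move=> Ba Bc ac e Be; have aU := divD (BU Ba); apply: (mulIr aU).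
have [_ Ca] := conj_ratio_central Ba Be.
have Wa := conj_ratio_weight Ba Be; have Wc := conj_ratio_weight Bc Be.
rewrite -!mulrA [a^-1 * a]mulVr // mulr1 Wc -(ac e Be) Wa.
rewrite -(Ca c Bc) -!mulrA; congr (c * _).
by rewrite (mulrA a^-1) (Ca _ (BV Ba)) -mulrA mulKr.
Qed.

(** A quaternion-like pair, with [u * u] left free; the last clause excludes [u = 0] and
    characteristic 2. *)
Definition anticommuting (i u : D) := [/\ i * i = - 1, u * i = - (i * u) & u * i <> i * u].

(* The first three conditions say that [i], [i - 1] or [(i - 1)^-1] is [h] for a
   square root [i] of [-1]; the last one is the order 3 unit
   [(- 1 - i + j - i j) / 2] of the Hurwitz quaternions. *)
Definition exceptional h := [\/ h * h = - 1, (1 + h) * (1 + h) = - 1,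
  (1 + h) * (1 + h) = - (h * h) | h * h + h + 1 = 0].

(** Case split on which of the characters of [be], [ga] and [1] coincide. Each coincidence reduces
    to [twisted_central], for [h], [- (1 + h)] or [- (1 + h^-1)], and that element forms the
    anticommuting pair with [b]; otherwise [generic_quaternion] applies. *)
Lemma normalizer_exceptional h b :
  normalizes h B -> normalizes (1 + h) B -> B b -> h * b <> b * h ->
  (exists i u, [/\ B i, B u & anticommuting i u]) /\ exceptional h.
Proof.
move=> [nh nhV] [_ nh1V] Bb hb.
have h0 : h != 0 by apply/eqP=> h0; apply: hb; rewrite h0 mul0r mulr0.
have h10 : 1 + h != 0.
  apply/eqP=> /eqP; rewrite addrC addr_eq0 => /eqP hN1.
  by apply: hb; rewrite hN1 mulN1r mulrN1.
have [hU h1U bU] := And3 (divD h0) (divD h10) (divD (BU Bb)).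
pose be := h * b * h^-1 * b^-1; pose ga := (1 + h) * b * (1 + h)^-1 * b^-1.
have Bbe : B be by apply: BM (BV Bb); have := nhV _ Bb; rewrite invrK.
have Bga : B ga by apply: BM (BV Bb); have := nh1V _ Bb; rewrite invrK.
have Eh : h * b = be * b * h by rewrite /be !mulrVK.
have E1h : (1 + h) * b = ga * b * (1 + h) by rewrite /ga !mulrVK.
have tw : twisted h b be ga by [].
clearbody be ga.
have [cbe|ncbe] := classic (centralizer B be).
  have [gah hh bh bhne] := twisted_central tw cbe.
  have Bh : B h by rewrite -gah.
  by split; [exists h, b | exact: Or41].
have [cga|ncga] := classic (centralizer B ga).
  (* Signs do not affect commutators and [1 - (1 + h) = - h], so this substitution swaps [be] and
     [ga]. *)
  have tw' : twisted (- (1 + h)) b ga be.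
    split=> //; first by rewrite mulNr E1h mulrN.
      have -> : 1 + - (1 + h) = - h by non_commutative_ring.
      by rewrite mulNr Eh mulrN.
    move=> e; apply: hb; apply: (addrI b).
    have -> : b + h * b = - (- (1 + h) * b) by non_commutative_ring.
    by rewrite e; non_commutative_ring.
  have [beh hh bh bhne] := twisted_central tw' cga.
  have Bh : B (- (1 + h)) by rewrite -beh.
  split; first by exists (- (1 + h)), b.
  by apply: Or42; rewrite -hh; non_commutative_ring.
have [cgb|ncgb] := classic (centralizer B (ga * be^-1)).
  have beU := divD (BU Bbe).
  have hVb : h^-1 * be * b = b * h^-1.
    by apply: (mulIr hU); rewrite mulrVK // -!mulrA [be * _]mulrA -Eh mulKr.
  (* As [1 + h^-1 = h^-1 * (1 + h)], its commutator with [b] is a conjugate by [h] of [ga * be^-1],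
     hence central in [B]. *)
  have tw' : twisted (- (1 + h^-1)) b (h^-1 * (ga * be^-1) * h) (h^-1 * be^-1 * h).
    have h'E : 1 + h^-1 = h^-1 * (1 + h) by rewrite mulrDr mulr1 mulVr // addrC.
    split.
    - split=> //; first exact: nh (BM Bga (BV Bbe)).
      exact: nh (BV Bbe).
    - rewrite mulNr mulrN h'E; congr (- _).
      rewrite -[LHS]mulrA E1h.
      transitivity (h^-1 * ga * be^-1 * h * (b * h^-1) * (1 + h)).
        by rewrite -hVb !mulrA mulrK // mulrVK.
      by rewrite !mulrA.
    - have -> : 1 + - (1 + h^-1) = - h^-1 by non_commutative_ring.
      rewrite mulNr mulrN; congr (- _).
      by rewrite -[RHS]mulrA -hVb !mulrA mulrK // mulrVK.
    - move=> e; apply: hb; rewrite -{1 2}[h]invrK; apply/esym/commrV.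
      apply: (addrI b).
      have -> : b + b * h^-1 = - (b * - (1 + h^-1)) by non_commutative_ring.
      by rewrite -e; non_commutative_ring.
  have cd : centralizer B (h^-1 * (ga * be^-1) * h).
    move=> c Bc; have := cgb _ (nhV c Bc); rewrite invrK => e.
    transitivity (h^-1 * (ga * be^-1 * (h * c * h^-1)) * h).
      by rewrite !mulrA mulrVK.
    by rewrite e !mulrA mulVr // mul1r.
  have [gah hh bh bhne] := twisted_central tw' cd.
  have Bh : B (- (1 + h^-1)) by rewrite -gah; exact: nh (BV Bbe).
  split; first by exists (- (1 + h^-1)), b.
  apply: Or43; have -> : 1 + h = (1 + h^-1) * h by rewrite mulrDl mulVr // mul1r addrC.
  have comm : h * (1 + h^-1) = (1 + h^-1) * h.
    by rewrite mulrDr mulrDl mulr1 mul1r mulrV // mulVr.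
  rewrite mulrNN in hh.
  by rewrite -mulrA [h * _]mulrA comm -mulrA mulrA hh mulN1r.
have [bb gb gb_ne hh] : [/\ be * be = - 1, ga * be = - (be * ga),
    ga * be <> be * ga & h * h + h + 1 = 0].
  apply: generic_quaternion tw _ _ _; apply: NNPP => nex.
  - apply: ncbe; apply: conj_ratio1_central => // c Bc.
    by apply: NNPP => ne; apply: nex; exists c.
  - apply: ncga; apply: conj_ratio1_central => // c Bc.
    by apply: NNPP => ne; apply: nex; exists c.
  - apply: ncgb; apply: conj_ratio_eq_central => // c Bc.
    by apply: NNPP => ne; apply: nex; exists c.
by split; [exists be, ga | exact: Or44].
Qed.

End Twist.

(** * Quaternion-like pairs *)

(** The commutator of [i] with [p + q] is [2 * i * q], and neither [2] nor [i] is zero. *)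
Lemma anticommuting_split i u p q : anticommuting i u ->
  p * i = i * p -> q * i = - (i * q) -> p + q = 0 -> q = 0.
Proof.
case=> ii ui une pi qi pq0; have n2 : (1 + 1 : D) != 0.
  apply/eqP=> n2; apply: une; rewrite ui; apply/esym/eqP; rewrite -addr_eq0.
  have -> : i * u + i * u = (1 + 1) * (i * u) by non_commutative_ring.
  by rewrite n2 mul0r.
have i0 : i != 0 by apply/eqP=> i0; apply: une; rewrite i0 mul0r mulr0.
have : i * ((1 + 1) * q) = 0.
  transitivity (i * (p + q) - (p + q) * i).
    by rewrite [(p + q) * i]mulrDl pi qi; non_commutative_ring.
  by rewrite pq0 mulr0 mul0r subrr.
case/div_mul_eq0 => [/eqP|/div_mul_eq0 [/eqP|//]]; first by rewrite (negPf i0).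
by rewrite (negPf n2).
Qed.

Lemma anticommuting_double_neq0 i u : anticommuting i u -> u + u <> 0.
Proof.
move=> iu uu; have [ii ui une] := iu.
by apply: une; apply/esym/eqP; rewrite ui -addr_eq0 -mulrDr uu mulr0.
Qed.

(** [u * u] commutes with [i], so in each of the other three quadratics the anticommuting part
    [u + u] or [u] would vanish. *)
Lemma anticommuting_exceptional i u : anticommuting i u -> exceptional u -> u * u = - 1.
Proof.
move=> iu; have [ii ui une] := iu; have uu := anticommuting_double_neq0 iu.
have uui : u * u * i = i * (u * u) by rewrite -mulrA ui mulrN (mulrA u i u) ui mulNr opprK -mulrA.
have uui2 : (u + u) * i = - (i * (u + u)) by rewrite mulrDl mulrDr ui opprD.
case=> // e; exfalso.
- apply: uu; apply: (anticommuting_split (p := 1 + 1 + u * u) iu _ uui2).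
    by rewrite mulrDl mulrDr uui; non_commutative_ring.
  transitivity ((1 + u) * (1 + u) + 1); first by non_commutative_ring.
  by rewrite e addNr.
- apply: uu; apply: (anticommuting_split (p := 1 + u * u + u * u) iu _ uui2).
    by rewrite !mulrDl !mulrDr uui; non_commutative_ring.
  transitivity ((1 + u) * (1 + u) + u * u); first by non_commutative_ring.
  by rewrite e addNr.
- apply: une; rewrite (anticommuting_split (p := u * u + 1) (q := u) iu) ?mulr0 ?mul0r //.
    by rewrite mulrDl mulrDr uui; non_commutative_ring.
  by rewrite -e; non_commutative_ring.
Qed.

(** Here [(i + u)^2 = u^2 - 1] commutes with [i]. The first quadratic gives [u^2 = 0]; in the others
    the anticommuting part is [u + u] or [u]. *)
Lemma anticommuting_add_not_exceptional i u : anticommuting i u -> ~ exceptional (i + u).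
Proof.
move=> iu; have [ii ui une] := iu; have uu := anticommuting_double_neq0 iu.
have uui : u * u * i = i * (u * u) by rewrite -mulrA ui mulrN (mulrA u i u) ui mulNr opprK -mulrA.
have uui2 : (u + u) * i = - (i * (u + u)) by rewrite mulrDl mulrDr ui opprD.
have sq : (i + u) * (i + u) = u * u - 1.
  have -> : (i + u) * (i + u) = i * i + i * u + u * i + u * u by non_commutative_ring.
  by rewrite ii ui; non_commutative_ring.
have u0 : u <> 0 by move=> u0; apply: uu; rewrite u0 addr0.
rewrite /exceptional sq; case=> e.
- have /div_mul_eq0 [] // : u * u = 0.
  by rewrite -[LHS](subrK 1) e addNr.
- apply: uu; apply: (anticommuting_split (p := u * u + 1 + i + i) iu _ uui2).
    by rewrite !mulrDl !mulrDr uui; non_commutative_ring.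
  transitivity ((1 + (i + u)) * (1 + (i + u)) + 1 - (i + u) * (i + u) + (u * u - 1)).
    by non_commutative_ring.
  by rewrite e sq; non_commutative_ring.
- apply: uu; apply: (anticommuting_split (p := u * u + u * u - 1 + i + i) iu _ uui2).
    by rewrite !mulrDl !mulrDr uui; non_commutative_ring.
  transitivity ((1 + (i + u)) * (1 + (i + u)) + (u * u - 1)
    - (i + u) * (i + u) + (u * u - 1)); first by non_commutative_ring.
  by rewrite e sq; non_commutative_ring.
- apply: u0; apply: (anticommuting_split (p := u * u + i) iu _ ui).
    by rewrite mulrDl mulrDr uui.
  by rewrite -e; non_commutative_ring.
Qed.

(* [u] is exceptional only if [u u = -1]; then [((1 + i) u)^2 = - 2]. *)
Lemma anticommuting_nonexceptional_pair i u : anticommuting i u ->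
  exists v, [/\ v = u \/ v = (1 + i) * u, ~ exceptional v, ~ exceptional (i + v)
    & v * (i + v) <> (i + v) * v].
Proof.
move=> iu; have [ii ui une] := iu.
have [v [vE iv vv]] : exists v,
    [/\ v = u \/ v = (1 + i) * u, anticommuting i v & v * v <> - 1].
  have [uu|] := classic (u * u = - 1); last by exists u; split; [left | |].
  exists ((1 + i) * u); split; [by right | split => // |].
  - by rewrite -mulrA ui; non_commutative_ring.
  - rewrite -mulrA ui => e; have := anticommuting_double_neq0 iu; apply.
    have : (1 + i) * (i * (u + u)) = 0.
      transitivity (i * ((1 + i) * u) - (1 + i) * - (i * u)).
        by non_commutative_ring.
      by rewrite e subrr.
    case/div_mul_eq0 => [/eqP|].
      rewrite addrC addr_eq0 => /eqP i1; case: une.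
      by rewrite i1 mulN1r mulrN1.
    by case/div_mul_eq0 => // i0; case: une; rewrite i0 mul0r mulr0.
  - have -> : (1 + i) * u * ((1 + i) * u) = (1 + i) * (u * u + u * i * u).
      by non_commutative_ring.
    rewrite ui; have -> : (1 + i) * (u * u + - (i * u) * u) = (1 - i * i) * (u * u).
      by non_commutative_ring.
    rewrite ii uu => e; have /eqP := oner_neq0 D; apply.
    transitivity (- ((1 - - 1) * - 1) - 1 : D); first by non_commutative_ring.
    by rewrite e opprK subrr.
exists v; split=> //.
- by move=> /(anticommuting_exceptional iv).
- exact: anticommuting_add_not_exceptional.
- have [_ _ vne] := iv; rewrite mulrDr mulrDl => /addIr; exact: vne.
Qed.

(** * Commutativity of [K] when [K^*] is locally solvable *)

(** [step] is used twice: a noncommuting pair yields an anticommuting one in [K], from which a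
    noncommuting pair without exceptional member is built, and this contradicts [step]. *)
Theorem locally_solvable_division_subring_abelian K :
  division_subring K -> locally_solvable (star K) -> abelian_set K.
Proof.
move=> dK lsK.
have step x y : K x -> K y -> x * y <> y * x ->
    (exists i u, [/\ K i, K u & anticommuting i u]) /\ (exceptional x \/ exceptional y).
  move=> Kx Ky xy.
  have [B [h [b [[grB BK] clB hxy [nh n1h] [Bb hb]]]]] :=
    solvable_class2_normalized dK lsK Kx Ky xy.
  have [[i [u [Bi Bu iu]]] exh] := normalizer_exceptional grB clB nh n1h Bb hb.
  split; first by exists i, u; split; [exact: BK | exact: BK |].
  by case: hxy exh => ->; [left | right].
move=> x y Kx Ky; apply: NNPP => xy.
have [[i [u [Ki Ku iu]]] _] := step x y Kx Ky xy.
have [v [vE ev eiv vne]] := anticommuting_nonexceptional_pair iu.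
have [_ K1 _ KM _] := dK.
have KD z t : K z -> K t -> K (z + t) by exact: division_subring_add.
have Kv : K v by case: vE => ->; [|apply: KM => //; exact: KD].
by case: (step _ _ Kv (KD _ _ Ki Kv) vne) => _ [].
Qed.

(** * Division subrings normalized by a maximal subgroup *)

(* Cartan-Brauer-Hua. *)
Lemma normal_division_subring_central K : division_subring K ->
  (forall d, d != 0 -> normalizes d K) -> ~ (forall x, K x) -> subs K (@center D).
Proof.
move=> dK nK nT; have [K0 K1 KB KM KV] := dK.
(* The conjugates [c] and [g] of [a] by [d] and [1 + d] lie in [K] and satisfy
   [(c - g) * d = g - a]. This puts [d] in [K] unless [c = g], and then [g = a], so [d] commutes
   with [a]. *)
have alt d a : K a -> K d \/ d * a = a * d.
  move=> Ka; have [->|d0] := eqVneq d 0; first by left.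
  have [d1|d1] := eqVneq (1 + d) 0.
    by right; move/eqP: d1; rewrite addrC addr_eq0 => /eqP ->; rewrite mulN1r mulrN1.
  have [_ nd] := nK d d0; have [_ nd1] := nK _ d1.
  have := nd _ Ka; have := nd1 _ Ka; rewrite !invrK.
  set g := (1 + d) * a * _; set c := d * a * _ => Kg Kc.
  have [dU d1U] := (divD d0, divD d1).
  have cd : c * d = d * a by rewrite /c mulrVK.
  have gd : g * (1 + d) = (1 + d) * a by rewrite /g mulrVK.
  have e : (c - g) * d = g - a.
    transitivity (c * d - g * (1 + d) + g); first by non_commutative_ring.
    by rewrite cd gd; non_commutative_ring.
  have [cg|cg] := eqVneq c g.
    right; have : g - a = 0 by rewrite -e cg subrr mul0r.
    by move/eqP; rewrite subr_eq0 => /eqP ga; rewrite -[LHS]cd cg ga.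
  left; rewrite -subr_eq0 in cg.
  have -> : d = (c - g)^-1 * (g - a) by rewrite -e mulKr // divD.
  by apply: KM; [apply: KV => //|]; exact: KB.
have [d nKd] : exists d, ~ K d.
  by apply: NNPP => ne; apply: nT => z; apply: NNPP => nz; apply: ne; exists z.
have out z a : ~ K z -> K a -> z * a = a * z by move=> nKz /(alt z) [/nKz|].
move=> a Ka z; have [Kz|nKz] := classic (K z); last by rewrite (out z a).
(* An element [z] of [K] is the difference of [d + z] and [d], both outside [K] and so commuting
   with [a]. *)
have nKdz : ~ K (d + z).
  by move=> Kdz; apply: nKd; rewrite -(addrK z d); exact: KB.
by have := out _ a nKdz Ka; rewrite mulrDl mulrDr (out d a) // => /addrI.
Qed.

Lemma locally_solvable_sub S M : subs S M -> locally_solvable M -> locally_solvable S.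
Proof. by move=> SM lsM s Ss; apply: lsM => x /Ss /SM. Qed.

Lemma derivedn_mono G H n :
  subs G H -> subs (iter n (@derived D) G) (iter n (@derived D) H).
Proof. by move=> GH; elim: n => //= n; exact: derived_mono. Qed.

Definition mul_set S T : D -> Prop := fun x => exists m p, [/\ S m, T p & x = m * p].

Lemma mul_set_mgroup M P : mgroup M -> mgroup P ->
  (forall m, M m -> conj_stable m P) -> mgroup (mul_set M P).
Proof.
move=> [MU M1 MM MV] [PU P1 PM PV] nP; split.
- by move=> _ [m [p [/MU m0 /PU p0 ->]]]; exact: div_mul_neq0.
- by exists 1, 1; rewrite mulr1.
- move=> _ _ [m [p [Mm Pp ->]]] [n [q [Mn Pq ->]]].
  exists (m * n), (n^-1 * p * n * q); split; [exact: MM | |].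
    by apply: PM => //; exact: nP.
  by rewrite -!mulrA (mulrA n) mulrV ?mul1r //; exact/divD/MU.
- move=> _ [m [p [Mm Pp ->]]]; have [mU pU] := (divD (MU _ Mm), divD (PU _ Pp)).
  exists m^-1, (m * p^-1 * m^-1); split; [exact: MV | |].
    by have := nP _ (MV _ Mm) _ (PV _ Pp); rewrite invrK.
  by rewrite invrM // !mulrA mulVr // mul1r.
Qed.

Lemma center_division_subring : division_subring (@center D).
Proof.
have := centralizer_division_subring (fun=> True).
by case=> C0 C1 CB CM CV; split; [exact: (fun y => C0 y I) | exact: (fun y => C1 y I)
  | move=> x y cx cy z; apply: CB | move=> x y cx cy z; apply: CM
  | move=> x cx x0 z; apply: CV].
Qed.

(** Central factors cancel in commutators, so only the [M]-factors of the generators, collected in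
    [t], matter for the derived group. *)
Lemma locally_solvable_mul_center M : mgroup M -> locally_solvable M ->
  locally_solvable (mul_set M (star (@center D))).
Proof.
move=> grM lsM s sMF; have [MU _ _ _] := grM.
have [t [tM st]] : exists t : seq D, (forall x, x \in t -> M x) /\
    forall x, x \in s -> mul_set (fun m => m \in t) (star (@center D)) x.
  elim: s sMF => [|x s IHs] sMF; first by exists [::].
  have [|t [tM st]] := IHs; first by move=> z zs; apply: sMF; rewrite inE zs orbT.
  have [m [f [Mm Ff xE]]] := sMF x (mem_head x s).
  exists (m :: t); split=> z; rewrite inE => /orP [/eqP ->|] //; first exact: tM.
    by exists m, f; rewrite mem_head.
  by move=> /st [n [g [nt Fg zE]]]; exists n, g; rewrite inE nt orbT.
have grT : mgroup (gen (fun x => x \in t)) by apply: gen_mgroup => x /tM /MU.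
have grF := star_mgroup center_division_subring.
have sub : subs (gen (fun x => x \in s))
    (mul_set (gen (fun x => x \in t)) (star (@center D))).
  apply: gen_min => [|x /st [m [f [mt Ff ->]]]]; last first.
    by exists m, f; split=> //; exact: gen_sub.
  apply: mul_set_mgroup => // m Mm a [Ca a0]; have mU : m \is a GRing.unit.
    by apply: divD; case: grT => TU _ _ _; exact: TU.
  by rewrite -mulrA Ca mulKr.
have dsub : subs (derived (gen (fun x => x \in s))) (derived (gen (fun x => x \in t))).
  apply: gen_min; first exact: derived_mgroup.
  move=> _ [x [y [/sub [m [f [Tm [Cf f0] ->]]] /sub [n [g [Tn [Cg g0] ->]]] ->]]].
  apply: gen_sub; exists m, n; split=> //.
  have [TU _ _ _] := grT; have [mU nU] := (divD (TU _ Tm), divD (TU _ Tn)).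
  have [fU gU] := (divD f0, divD g0).
  have CfV z : f^-1 * z = z * f^-1 by apply/esym/commrV/esym/Cf.
  have CgV z : g^-1 * z = z * g^-1 by apply/esym/commrV/esym/Cg.
  rewrite !invrM // -!mulrA CfV -!mulrA CgV -!mulrA (CfV g^-1) mulVKr //.
  by rewrite (Cf (n * f^-1)) mulrVK.
(* The inclusion [dsub] starts at the first derived group, hence [n.+1]. *)
have [n Tn] := lsM t tM; exists n.+1 => x; rewrite iterSr => /(derivedn_mono (n := n) dsub).
by rewrite -iterSr => /(derived_sub (derivedn_mgroup n grT)) /Tn.
Qed.

(* Otherwise [M P^*] is all of [D^*], which makes [P] central and then [D^*]
   locally solvable. *)
Lemma maximal_absorbs_normalized M P : noncommutative_ring D ->
  maximal_subgroup M -> locally_solvable M -> division_subring P ->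
  (forall m, M m -> conj_stable m P) -> ~ (forall x, P x) -> subs (star P) M.
Proof.
move=> [x0 [y0 xy]] [grM nM maxM] lsM dP nP nT; have [MU M1 _ MV] := grM.
have grP := star_mgroup dP; have [_ P1 _ _] := grP.
have nPs m : M m -> conj_stable m (star P).
  move=> Mm a [Pa a0]; split; first exact: nP.
  by do 2?apply: div_mul_neq0; rewrite ?div_inv_neq0 //; exact: MU.
have Mmul : subs M (mul_set M (star P)) by move=> m Mm; exists m, 1; rewrite mulr1.
case: (maxM _ (mul_set_mgroup grM grP nPs) Mmul) => eqMP.
  by move=> x Px; apply/eqMP; exists 1, x; rewrite mul1r.
have cP : subs P (@center D).
  apply: normal_division_subring_central => // d d0.
  (* Every unit is a product [m * p], and both factors stabilize [P]. *)
  have st e : e != 0 -> conj_stable e P.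
    move=> /eqMP [m [p [Mm [Pp p0] ->]]] a Pa; have [_ _ _ PM PV] := dP.
    have [mU pU] := (divD (MU m Mm), divD p0).
    have -> : (m * p)^-1 * a * (m * p) = p^-1 * (m^-1 * a * m) * p.
      by rewrite invrM // !mulrA.
    by apply: (PM) => //; apply: (PM); [exact: PV | exact: nP].
  by split; [exact: st | apply: st; exact: div_inv_neq0].
have lsD : locally_solvable (star (fun _ : D => True)).
  apply: locally_solvable_sub (locally_solvable_mul_center grM lsM) => d [_ d0].
  by have /eqMP [m [p [Mm [/cP Cp p0] ->]]] := d0; exists m, p.
have dT : division_subring (fun _ : D => True) by [].
by case/eqP: xy; exact: locally_solvable_division_subring_abelian dT lsD _ _ I I.
Qed.

(** * The division subring [F(S)] and centralizers *)

Lemma adjoin_division_subring S : division_subring (adjoin S).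
Proof.
split=> [L []//|L []//|x y ax ay L dL cL SL|x y ax ay L dL cL SL|x ax x0 L dL cL SL];
  have [Lx [_ _ LB LM LV]] := (ax L dL cL SL, dL); [| |exact: LV];
  have Ly := ay L dL cL SL; [exact: LB | exact: LM].
Qed.

Lemma sub_adjoin S : subs S (adjoin S).
Proof. by move=> x Sx L _ _; apply. Qed.

Lemma center_adjoin S : subs (@center D) (adjoin S).
Proof. by move=> x cx L _ cL _; exact: cL. Qed.

(** The double centralizer of [S] is a division subring containing the center and [S], hence also
    [adjoin S]. *)
Lemma centralizer_adjoin S : seteq (centralizer S) (centralizer (adjoin S)).
Proof.
move=> x; split=> [Cx z az|Cx s Ss]; last by apply: Cx; exact: sub_adjoin.
apply/esym; move: x Cx; apply: (az (centralizer (centralizer S))).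
- exact: centralizer_division_subring.
- by move=> c cc x _; exact: cc.
- by move=> s Ss x Cx; rewrite Cx.
Qed.

(** [adjoin S] lies in the centralizer of [S], which is also the centralizer of [adjoin S]. *)
Lemma adjoin_abelian S : abelian_set S -> abelian_set (adjoin S).
Proof.
move=> abS x y ax ay; have : centralizer S y.
  apply: (ay (centralizer S)) => [|c cc s _|s Ss t St].
  - exact: centralizer_division_subring.
  - exact: cc.
  - exact: abS.
by move=> /centralizer_adjoin Cy; rewrite Cy.
Qed.

Lemma conj_division_subring g L : g != 0 -> division_subring L ->
  division_subring (fun x => L (g^-1 * x * g)).
Proof.
move=> g0 [L0 L1 LB LM LV]; have gU := divD g0; split.
- by rewrite mulr0 mul0r.
- by rewrite mulr1 mulVr.
- by move=> x y Lx Ly; rewrite mulrBr mulrBl; exact: LB.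
- by move=> x y Lx Ly; have := LM _ _ Lx Ly; rewrite !mulrA mulrK.
- move=> x Lx x0; have xU := divD x0.
  have -> : g^-1 * x^-1 * g = (g^-1 * x * g)^-1.
    by rewrite !invrM ?unitrMr ?unitrV // invrK mulrA.
  by apply: LV => //; do 2?apply: div_mul_neq0 => //; exact: div_inv_neq0.
Qed.

Lemma conj_stable_adjoin g S : g != 0 -> conj_stable g S ->
  conj_stable g (adjoin S).
Proof.
move=> g0 gS x ax; apply: (ax (fun x => adjoin S (g^-1 * x * g))).
- exact/conj_division_subring/adjoin_division_subring.
- move=> c cc; rewrite -mulrA cc mulKr ?divD //; exact: center_adjoin.
- by move=> s Ss; apply: sub_adjoin; exact: gS.
Qed.

Lemma conj_stable_centralizer g S : g != 0 -> conj_stable g^-1 S ->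
  conj_stable g (centralizer S).
Proof.
move=> g0 gS x Cx s Ss; have gU := divD g0; have := Cx _ (gS s Ss).
rewrite invrK => e.
transitivity (g^-1 * (x * (g * s * g^-1)) * g); first by rewrite !mulrA mulrVK.
by rewrite e !mulrA mulVr // mul1r.
Qed.

End DivisionRing.

(** * Identifying [A], [V] and [K] *)

Theorem theorem2p2 (D : unitRingType) (M A : D -> Prop) :
  is_division_ring D -> noncommutative_ring D ->
  maximal_subgroup M -> ~ abelian_set M -> locally_solvable M ->
  max_abelian_normal A M ->
  let L := adjoin A in
  let K := centralizer L in
  let V := centralizer_in M A in
  seteq A (star L) /\
  (seteq A (star (@center D)) \/
   (seteq V (star L) /\ seteq (star L) (star K) /\ maximal_subfield K)).
Proof.
move=> divD ncD maxM _ lsM [[grA AM nA] abA maxA] L K V.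
have [grM _ _] := maxM; have [MU _ _ MV] := grM.
have dL : division_subring L := adjoin_division_subring A.
have abL : abelian_set L := adjoin_abelian abA.
have nAm m : M m -> conj_stable m A by move=> Mm a; exact: nA.
have nLm m : M m -> conj_stable m L.
  by move=> Mm; apply: conj_stable_adjoin (nAm m Mm) => //; exact: MU.
(* [L] is commutative, hence proper, and is normalized by [M]. *)
have LM : subs (star L) M.
  apply: maximal_absorbs_normalized => //.
  by case: ncD => x [y /eqP xy] LT; apply: xy; apply: abL.
have abelian_star (P : D -> Prop) : abelian_set P -> abelian_set (star P).
  by move=> abP x y [Px _] [Py _]; exact: abP.
have normal_star (P : D -> Prop) : division_subring P -> subs (star P) M ->
    (forall m, M m -> conj_stable m P) -> normal_sub (star P) M.
  move=> dP PM nP; split=> [||m a Mm [Pa a0]]; [exact: star_mgroup | exact: PM |].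
  split; first exact: nP.
  apply: div_mul_neq0 => //; last exact: MU.
  by apply: div_mul_neq0 => //; apply: div_inv_neq0 => //; exact: MU.
have AL : subs A (star L).
  by move=> a Aa; split; [exact: sub_adjoin | case: grA => AU _ _ _; exact: AU].
(* [L^*] is an abelian normal subgroup of [M] containing [A], so maximality of [A] applies. *)
have eqAL : seteq A (star L).
  by move=> x; have := maxA _ (normal_star L dL LM nLm) (abelian_star L abL) AL x; case.
split=> //.
have [|nAF] := classic (seteq A (star (@center D))); [by left | right].
(* [A = L^*] contains [F^*], so it has a noncentral element, which makes [K] proper. *)
have [a Aa ncA] : exists2 a, A a & ~ center a.
  apply: NNPP => ne; apply: nAF => x; split=> [Ax|[cx x0]].
    split; last by case: (AL x Ax).
    by apply: NNPP => ncx; apply: ne; exists x.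
  by apply/eqAL; split=> //; exact: center_adjoin.
have La : L a by exact: sub_adjoin.
have dK : division_subring K := centralizer_division_subring L.
have nKm m : M m -> conj_stable m K.
  move=> Mm; apply: conj_stable_centralizer => //; first exact: MU.
  exact: nLm _ (MV m Mm).
have KM : subs (star K) M.
  apply: maximal_absorbs_normalized => // KT.
  by apply: ncA => y; rewrite (KT y a La).
have abK : abelian_set K.
  apply: locally_solvable_division_subring_abelian => //.
  exact: locally_solvable_sub lsM.
have LK : subs L K by move=> x Lx y Ly; exact: abL.
have AK : subs A (star K) by move=> x /AL [Lx x0]; split=> //; exact: LK.
(* Now that [K] is commutative, [K^*] too is an abelian normal subgroup of [M] containing [A]. *)
have eqKA := maxA _ (normal_star K dK KM nKm) (abelian_star K abK) AK.
split=> [x|]; last split=> [x|].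
- split=> [[Mx Cx]|/eqAL Ax]; last by split; [exact: AM | move=> s As; exact: abA].
  apply/eqAL/eqKA; split; last exact: MU.
  exact: (proj1 (centralizer_adjoin A x) Cx).
- by split=> [/eqAL /eqKA|/eqKA /eqAL].
(* A subfield containing [K] contains [L], so it centralizes [L] and lies in [K]. *)
- split=> // K' [_ abK'] KK' x; split=> [K'x l Ll|]; last exact: KK'.
  by apply: abK' => //; exact/KK'/LK.
Qed.
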